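(* Let $(\Omega,\mathcal A,\mu)$ be a $\sigma$-finite, quasi-non-atomic measure space with $\mu(\Omega)=\infty$. For a fully symmetric space $X\subset L^1+L^\infty$ on $(\Omega,\mathcal A,\mu)$, the following conditions are equivalent: (i) $X\subseteq\mathcal R_\mu$; (ii) $\mathbf 1\notin X$; (iii) for every $f\in X$ and every $T\in DS$ the averages $M_n(T)(f)=\frac1n\sum_{k=0}^{n-1}T^k(f)$ converge almost uniformly to some $\widehat f\in X$.
   Context: All measure spaces are complete. $(\Omega,\mathcal A,\mu)$ is quasi-non-atomic if it has finitely many (possibly no) atoms or all its atoms have the same measure. $L^0=L^0(\Omega)$ is the algebra of (classes of) a.e. finite real-valued measurable functions on $\Omega$; $L^p=L^p(\Omega)$, $1\le p\le\infty$, are the real $L^p$-spaces; $\mathbf 1=\chi_\Omega$. $L^0_\mu$ is the set of $f\in L^0$ with $\mu\{|f|>\lambda\}<\infty$ for some $\lambda>0$. For $f\in L^0_\mu$, $f^*(t)=\inf\{\lambda>0:\mu\{|f|>\lambda\}\le t\}$, $t>0$. Let $\nu$ be Lebesgue measure on $(0,\infty)$. A nonzero linear subspace $X\subset L^0_\nu$ with a Banach norm $\|\cdot\|_X$ is fully symmetric on $((0,\infty),\nu)$ if $f\in X$, $g\in L^0_\nu$ and $\int_0^s g^*(t)\,dt\le\int_0^s f^*(t)\,dt$ for all $s>0$ imply $g\in X$ and $\|g\|_X\le\|f\|_X$. A fully symmetric space on $(\Omega,\mathcal A,\mu)$ is a space $X(\Omega)=\{f\in L^0_\mu: f^*\in X\}$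 with norm $\|f\|_{X(\Omega)}=\|f^*\|_X$, where $X$ is a fully symmetric space on $((0,\infty),\nu)$. $\mathcal R_\mu=\{f\in L^1+L^\infty:\ \mu\{|f|>\lambda\}<\infty\text{ for all }\lambda>0\}$. $T\in DS$ means $T:L^1+L^\infty\to L^1+L^\infty$ is linear with $\|T(f)\|_1\le\|f\|_1$ for all $f\in L^1$ and $\|T(f)\|_\infty\le\|f\|_\infty$ for all $f\in L^\infty$. $\{f_n\}\subset L^0$ converges almost uniformly to $f\in L^0$ if for every $\epsilon>0$ there is a measurable $E\subset\Omega$ with $\mu(\Omega\setminus E)\le\epsilon$ and $\|(f-f_n)\chi_E\|_\infty\to0$. *)

(* Defs.v *)
From HB Require Import structures.
From mathcomp Require Import all_boot all_order all_algebra.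
From mathcomp Require Import all_classical all_reals all_analysis.

Set Implicit Arguments.
Unset Strict Implicit.
Unset Printing Implicit Defensive.

Import Order.TTheory GRing.Theory Num.Theory.
Import numFieldNormedType.Exports.

Local Open Scope classical_set_scope.
Local Open Scope ring_scope.

(* Classes of a.e. finite measurable functions on a measurable set D are handled
   through everywhere finite representatives T -> R, of which only the values on
   D matter; every notion below is invariant under a.e. equality on D. *)
Section function_classes.
Context {d : measure_display} {T : measurableType d} {R : realType}.
Variables (mu : {measure set T -> \bar R}) (D : set T).

Definition distribution_fun (f : T -> R) (lambda : R) : \bar R :=
  mu (D `&` [set x | lambda < `|f x|]).

Definition L0_mu : set (T -> R) :=
  [set f | measurable_fun D f /\
    exists2 lambda, 0 < lambda & (distribution_fun f lambda < +oo)%E].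

(* For f in L0_mu and 0 < t the set is nonempty, so the infimum is a genuine
   one; values at t <= 0 are irrelevant. *)
Definition rearrangement (f : T -> R) (t : R) : R :=
  inf [set lambda | 0 < lambda /\ (distribution_fun f lambda <= t%:E)%E].

End function_classes.

Notation lebesgueTypeR R := (caratheodory_type (@wlength R idfun)^*%mu).
Notation lebesgue R := (@completed_lebesgue_measure R).

Definition half_line {R : realType} : set (lebesgueTypeR R) := `]0 : R, +oo[.

Section fully_symmetric_half_line.
Context {R : realType}.
Variables (X : set (R -> R)) (normX : (R -> R) -> R).

Definition L0_nu : set (R -> R) := L0_mu (lebesgue R) half_line.

Definition eq_nu (f g : R -> R) : Prop := ae_eq (lebesgue R) half_line f g.

Definition rearrangement_nu (f : R -> R) : R -> R :=
  rearrangement (lebesgue R) half_line f.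

(* Rearrangements are monotone, so their integrals may be taken with respect to
   the Lebesgue measure on Borel sets. *)
Definition submajorized (g f : R -> R) : Prop :=
  forall s : R, 0 < s ->
    (\int[lebesgue_measure]_(t in `]0%R, s[) (rearrangement_nu g t)%:E <=
     \int[lebesgue_measure]_(t in `]0%R, s[) (rearrangement_nu f t)%:E)%E.

Record fully_symmetric : Prop := FullySymmetric {
  fs_sub : X `<=` L0_nu ;
  fs_ae : forall f g : R -> R, X f ->
    @measurable_fun _ _ (lebesgueTypeR R) R half_line g -> eq_nu f g ->
    X g /\ normX g = normX f ;
  fs_nonzero : exists2 f : R -> R, X f & ~ eq_nu f (cst 0) ;
  fs_linear : forall (a : R) (f g : R -> R), X f -> X g ->
    X (fun t => a * f t + g t) ;
  fs_norm_eq0 : forall f : R -> R, X f -> normX f = 0 -> eq_nu f (cst 0) ;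
  fs_normZ : forall (a : R) (f : R -> R), X f ->
    normX (fun t => a * f t) = `|a| * normX f ;
  fs_normD : forall f g : R -> R, X f -> X g ->
    normX (f \+ g) <= normX f + normX g ;
  fs_complete : forall u : nat -> R -> R, (forall n, X (u n)) ->
    (forall e : R, 0 < e -> exists N : nat, forall m n : nat,
      (N <= m)%N -> (N <= n)%N -> normX (u m \- u n) < e) ->
    exists2 f : R -> R, X f & normX (u n \- f) @[n --> \oo] --> (0 : R) ;
  fs_majorization : forall f g : R -> R, X f -> L0_nu g ->
    submajorized g f -> X g /\ normX g <= normX f
}.

End fully_symmetric_half_line.

Section ergodic.
Context {d : measure_display} {T : measurableType d} {R : realType}.
Variable mu : {measure set T -> \bar R}.

Definition atom (A : set T) : Prop :=
  [/\ measurable A, (0 < mu A)%E &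
    forall B, measurable B -> B `<=` A -> mu B = 0%E \/ mu (A `\` B) = 0%E].

(* Atoms are counted up to null sets. *)
Definition finitely_many_atoms : Prop :=
  exists F : set (set T), [/\ finite_set F, F `<=` atom &
    forall A, atom A ->
      exists2 B, F B & mu ((A `\` B) `|` (B `\` A)) = 0%E].

Definition quasi_non_atomic : Prop :=
  finitely_many_atoms \/ (forall A B, atom A -> atom B -> mu A = mu B).

Definition fully_symmetric_on (X : set (T -> R)) (normX : (T -> R) -> R) :
    Prop :=
  exists (X0 : set (R -> R)) (normX0 : (R -> R) -> R),
    [/\ fully_symmetric X0 normX0,
        X = [set f | L0_mu mu setT f /\ X0 (rearrangement mu setT f)] &
        forall f, X f -> normX f = normX0 (rearrangement mu setT f)].

Definition L1_plus_Loo : set (T -> R) :=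
  [set f | exists g h : T -> R,
    [/\ g \in Lfun mu 1%E, h \in Lfun mu +oo%E & f = g \+ h]].

Definition R_mu : set (T -> R) :=
  [set f | L1_plus_Loo f /\
    forall lambda : R, 0 < lambda ->
      (distribution_fun mu setT f lambda < +oo)%E].

(* An operator on classes is given by its action on representatives. *)
Record DS (S : (T -> R) -> (T -> R)) : Prop := IsDS {
  DS_stable : forall f, L1_plus_Loo f -> L1_plus_Loo (S f) ;
  DS_ae : forall f g, L1_plus_Loo f -> L1_plus_Loo g ->
    f = g %[ae mu] -> S f = S g %[ae mu] ;
  DS_linear : forall (a : R) f g, L1_plus_Loo f -> L1_plus_Loo g ->
    S (fun x => a * f x + g x) = (fun x => a * S f x + S g x) %[ae mu] ;
  DS_L1 : forall f, f \in Lfun mu 1%E ->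
    ('N[mu]_1[EFin \o S f] <= 'N[mu]_1[EFin \o f])%E ;
  DS_Loo : forall f, f \in Lfun mu +oo%E ->
    ('N[mu]_+oo[EFin \o S f] <= 'N[mu]_+oo[EFin \o f])%E
}.

Definition average (S : (T -> R) -> (T -> R)) (n : nat) (f : T -> R) : T -> R :=
  fun x => n%:R^-1 * \sum_(k < n) iter k S f x.

Definition au_cvg (u : nat -> T -> R) (f : T -> R) : Prop :=
  forall e : R, 0 < e -> exists E : set T,
    [/\ measurable E, (mu (~` E) <= e%:E)%E &
      'N[mu]_+oo[EFin \o (fun x => (f x - u n x) * \1_E x)%R]%E @[n --> \oo]
        --> 0%E].

End ergodic.

(* Main.v *)
(* (i) <=> (ii): if [f] in [X] has [mu {|f| > a} = +oo] for some [a > 0], the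
   rearrangement of [f] is at least [a] on the half-line, so [1] is in [X].

   (i) => (iii): Chacon's filling scheme gives the weak type (1, 1) maximal
   inequality for every [S] in DS, positive or not. Since [S] contracts [L1] and
   [Loo], it does not increase the functionals [f |-> \int (|f| - t)^+], [t >= 0]
   (split [f] at height [t]), nor therefore the square norm of integrable bounded
   functions. For those, Riesz's parallelogram argument makes the averages Cauchy
   in square norm, and the maximal inequality turns this into almost uniform
   convergence. A function of [R_mu] is, up to a uniformly small function,
   integrable, and the maximal inequality concludes. By Fatou the limit [v] has
   [\int (|v| - t)^+ <= \int (|f| - t)^+] for all [t >= 0], which amounts to
   [v] being submajorized by [f], because
   [\int_0^s f^* = min_t (s t + \int (|f| - t)^+)]. Hence [v] is in [X].

   (iii) => (ii): if [1] is in [X], so is every bounded function. Let [A_k] be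
   disjoint sets of finite nondecreasing measures; replacing [f] on [A_k] by its
   mean over [A_{k+1}] is an operator in DS, whose averages on [A_0] are the
   Cesaro means of an arbitrary bounded sequence. *)
Require Import Defs.
From HB Require Import structures.
From mathcomp Require Import all_boot all_order all_algebra.
From mathcomp Require Import all_classical all_reals all_analysis.
From mathcomp Require Import measurable_realfun ess_sup_inf lra ring.

Set Implicit Arguments.
Unset Strict Implicit.
Unset Printing Implicit Defensive.

Import Order.TTheory GRing.Theory Num.Theory.
Import numFieldNormedType.Exports.

Local Open Scope classical_set_scope.
Local Open Scope ring_scope.

(** * Truncation *)

(** Estimates are phrased through [excess mu t f], the integral of [(|f| - t)^+], because this one
    family determines the square norm by integration in [t], controls the measure of level sets,
    passes to limits by Fatou and depends only on the distribution of [f]. It thereby replaces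
    interpolation between [L1] and [Loo] as well as Hilbert space theory. No invariant function is
    constructed. The averages are compared with an auxiliary function that depends on the tolerance,
    and the limit appears only at the end, as an upper limit; hence the convergence statements bound
    tail deviations from some [v] instead of naming the limit. An operator acts on representatives,
    so each instance of its linearity holds off its own null set. The proofs collect countably many
    instances with [ae_foralln] before arguing at a point. *)

Section truncation.
Context {R : realType}.
Implicit Types c y : R.

Definition trunc c y : R := Num.max (- c) (Num.min c y).

Lemma truncP c y : 0 <= c ->
  [\/ y < - c /\ trunc c y = - c, - c <= y <= c /\ trunc c y = y |
      c < y /\ trunc c y = c].
Proof.
move=> c0; rewrite /trunc /Num.max /Num.min; case: (ltP c y) => h1.
  by apply: Or33; split => //; case: ltP => // h; lra.
case: (ltP (- c) y) => h2.
  by apply: Or32; split => //; apply/andP; split => //; exact: ltW.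
have [h|h] := ltP y (- c); first exact: Or31.
by apply: Or32; split; [apply/andP; split|]; lra.
Qed.

Lemma trunc_bound c y : 0 <= c -> `|trunc c y| <= c.
Proof.
by move=> c0; case: (truncP y c0) => -[h ->]; rewrite ler_norml;
  apply/andP; split; lra.
Qed.

Lemma trunc_rest c y : 0 <= c -> `|y - trunc c y| = Num.max (`|y| - c) 0.
Proof.
move=> c0; rewrite /Num.max; case: (truncP y c0) => -[h ->].
- by rewrite !ltr0_norm; [case: ltP; lra|lra..].
- rewrite subrr normr0; case: ltP => //.
  have : `|y| <= c by rewrite ler_norml.
  by lra.
- by rewrite !gtr0_norm; [case: ltP; lra|lra..].
Qed.

(** The two pieces have the same sign, so cutting causes no cancellation: after integration the [L1]
    norms of the pieces add up exactly. *)
Lemma trunc_split c y : 0 <= c -> `|y - trunc c y| + `|trunc c y| = `|y|.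
Proof.
move=> c0; case: (truncP y c0) => -[h ->].
- have /orP[/eqP c1|c1] : (c == 0) || (0 < c) by rewrite -le0r.
    by rewrite c1 oppr0 subr0 normr0 addr0.
  by rewrite !ltr0_norm; lra.
- by rewrite subrr normr0 add0r.
- by rewrite gtr0_norm ?ger0_norm ?gtr0_norm; lra.
Qed.

Lemma trunc_id c y : `|trunc c y| < c -> trunc c y = y.
Proof.
move=> h; have c0 : 0 <= c by rewrite (le_trans _ (ltW h)).
case: (truncP y c0) h => -[h ->] //.
  by rewrite normrN ger0_norm// ltxx.
by rewrite ger0_norm// ltxx.
Qed.

Lemma trunc_le c y : 0 <= c -> `|trunc c y| <= `|y|.
Proof. by move=> c0; rewrite -[leRHS](trunc_split y c0) lerDr. Qed.

End truncation.

Lemma measurable_trunc d (T : measurableType d) (R : realType) (c f : T -> R) :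
  measurable_fun setT c -> measurable_fun setT f ->
  measurable_fun setT (fun x => trunc (c x) (f x)).
Proof.
move=> mc mf; apply: measurable_maxr; first exact: measurable_funN.
exact: measurable_minr.
Qed.

(** * Riemann sums for the square *)

Section layer_sums.
Context {R : realType}.
Implicit Types h x : R.

Let pos (x : R) := Num.max x 0.

(** The left side is the integral of [2 (x - t)^+] over [0 <= t <= n h]. The integrand decreases in
    [t], so the sum over left endpoints is too large, and the one over right endpoints, in
    [layer_sum_le], too small. *)
Lemma layer_sum_ge h x n : 0 <= h -> 0 <= x ->
  x ^+ 2 - pos (x - n%:R * h) ^+ 2 <= \sum_(k < n) 2 * h * pos (x - k%:R * h).
Proof.
move=> h0 x0; elim: n => [|n ih].
  by rewrite big_ord0 mul0r subr0 /pos (max_idPl x0) subrr.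
rewrite big_ord_recr/=.
suff : pos (x - n%:R * h) ^+ 2 - pos (x - n.+1%:R * h) ^+ 2 <=
    2 * h * pos (x - n%:R * h) by move: ih; lra.
have -> : x - n.+1%:R * h = x - n%:R * h - h by rewrite -[n.+1%:R]natr1; ring.
move: (x - _) => y; rewrite /pos /Num.max; case: ltP => h1; case: ltP => h2;
  by nra.
Qed.

Lemma layer_sum_le h x n : 0 <= h -> 0 <= x ->
  \sum_(k < n) 2 * h * pos (x - k.+1%:R * h) <= x ^+ 2.
Proof.
move=> h0 x0.
suff : \sum_(k < n) 2 * h * pos (x - k.+1%:R * h) <=
    x ^+ 2 - pos (x - n%:R * h) ^+ 2.
  by move=> /le_trans; apply; rewrite gerBl sqr_ge0.
elim: n => [|n ih].
  by rewrite big_ord0 mul0r subr0 /pos (max_idPl x0) subrr.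
rewrite big_ord_recr/=.
suff : 2 * h * pos (x - n.+1%:R * h) <=
  pos (x - n%:R * h) ^+ 2 - pos (x - n.+1%:R * h) ^+ 2 by move: ih; lra.
have -> : x - n.+1%:R * h = x - n%:R * h - h by rewrite -[n.+1%:R]natr1; ring.
move: (x - _) => y; rewrite /pos /Num.max; case: ltP => h1; case: ltP => h2;
  by nra.
Qed.

End layer_sums.

(** * The space L1 + Loo and Dunford-Schwartz operators *)

Section function_spaces.
Context {d : measure_display} {T : measurableType d} {R : realType}.
Variable mu : {measure set T -> \bar R}.
Implicit Types (f g h : T -> R) (c t : R).

Lemma le_measure_ae (A B : set T) : measurable A -> measurable B ->
  (\forall x \ae mu, A x -> B x) -> (mu A <= mu B)%E.
Proof.
move=> mA mB [N [mN N0 AB]].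
have AN : A `<=` B `|` N.
  move=> x Ax; have [Bx|nBx] := pselect (B x); [by left|right].
  by apply: AB => /(_ Ax).
rewrite (le_trans (le_measure _ _ _ AN)) ?inE//; first exact: measurableU.
by rewrite (le_trans (measureU2 _ _ _))//= N0 adde0.
Qed.

Definition norm1 f : \bar R := \int[mu]_x (`|f x|)%:E.

Definition excess t f : \bar R := \int[mu]_x (Num.max (`|f x| - t) 0)%:E.

Definition square_norm f : \bar R := \int[mu]_x (f x ^+ 2)%:E.

Definition integrable1 f := measurable_fun setT f /\ (norm1 f < +oo)%E.

Definition ae_bounded c f := \forall x \ae mu, `|f x| <= c.

Lemma norm1_ge0 f : (0 <= norm1 f)%E.
Proof. by apply: integral_ge0 => x _; rewrite lee_fin. Qed.

Lemma excess_ge0 t f : (0 <= excess t f)%E.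
Proof. by apply: integral_ge0 => x _; rewrite lee_fin le_max lexx orbT. Qed.

Lemma square_norm_ge0 f : (0 <= square_norm f)%E.
Proof. by apply: integral_ge0 => x _; rewrite lee_fin sqr_ge0. Qed.

Lemma measurable_excess t f : measurable_fun setT f ->
  measurable_fun setT (fun x => Num.max (`|f x| - t) 0).
Proof.
move=> mf; apply: measurable_maxr => //; apply: measurable_funB => //.
exact: measurableT_comp.
Qed.

Lemma measurable_setltr (f g : T -> R) : measurable_fun setT f ->
  measurable_fun setT g -> measurable [set x | f x < g x].
Proof.
move=> mf mg; have := measurable_fun_ltr mf mg.
by move=> /(_ measurableT [set true]); rewrite setTI; exact.
Qed.

Lemma measurable_setler (f g : T -> R) : measurable_fun setT f ->
  measurable_fun setT g -> measurable [set x | f x <= g x].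
Proof.
move=> mf mg; have := measurable_fun_ler mf mg.
by move=> /(_ measurableT [set true]); rewrite setTI; exact.
Qed.

Lemma measurable_setgt c f : measurable_fun setT f ->
  measurable [set x | c < `|f x|].
Proof.
by move=> mf; apply: measurable_setltr => //; exact: measurableT_comp.
Qed.

Lemma excess0 f : excess 0 f = norm1 f.
Proof.
by apply: eq_integral => x _; rewrite subr0 (max_idPl _).
Qed.

Lemma ge0_le_integral_ae (f g : T -> R) : measurable_fun setT f ->
  measurable_fun setT g -> (forall x, 0 <= f x) -> (forall x, 0 <= g x) ->
  (\forall x \ae mu, f x <= g x) ->
  (\int[mu]_x (f x)%:E <= \int[mu]_x (g x)%:E)%E.
Proof.
move=> mf mg f0 g0 fg; apply: ae_ge0_le_integral => //.
- by move=> x _; rewrite lee_fin.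
- exact/measurable_EFinP.
- by move=> x _; rewrite lee_fin.
- exact/measurable_EFinP.
- by apply: filterS fg => x fg _; rewrite lee_fin.
Qed.

Lemma integrable1P f :
  integrable1 f <-> mu.-integrable setT (EFin \o f).
Proof.
split=> [[mf f1]|/integrableP[/measurable_EFinP mf f1]]; last by split.
by apply/integrableP; split=> //; exact/measurable_EFinP.
Qed.

Lemma Lfun1P f : f \in Lfun mu 1%E <-> integrable1 f.
Proof. by rewrite integrable1P; exact: Lfun1_integrable. Qed.

Lemma Lnormy_le c f : 0 <= c ->
  ('N[mu]_+oo[EFin \o f] <= c%:E)%E <-> ae_bounded c f.
Proof.
move=> c0; rewrite unlock /Lnorm; case: ifPn => [_|].
  split=> [/ess_supP|h]; first by apply: filterS => x /=; rewrite lee_fin.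
  by apply/ess_supP; apply: filterS h => x /=; rewrite lee_fin.
(* On a space of measure zero [Lnorm] at [+oo] is [0] by convention, and every property holds almost
   everywhere. *)
rewrite -leNgt measure_le0 => /eqP mu0; split => // _.
exact: (measure0_ae (fun x => `|f x| <= c)).
Qed.

Lemma LfunyP f : f \in Lfun mu +oo%E <->
  measurable_fun setT f /\ exists2 c, 0 <= c & ae_bounded c f.
Proof.
rewrite inE; split.
  move=> /andP[mf fn]; move: mf fn; rewrite !inE/= => mf fn; split => //.
  have f0 := Lnorm_ge0 mu +oo%E (EFin \o f).
  exists (fine ('N[mu]_+oo[EFin \o f])%E); first exact: fine_ge0.
  by apply/Lnormy_le; [exact: fine_ge0|rewrite fineK// ge0_fin_numE].
move=> [mf [c c0 /(Lnormy_le _ c0) fc]].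
by apply/andP; split; rewrite inE//= /finite_norm (le_lt_trans fc)// ltry.
Qed.

Local Notation V := (L1_plus_Loo mu).

Lemma integrable1_L1Loo f : integrable1 f -> V f.
Proof.
move=> f1; exists f, (cst 0); split; first exact/Lfun1P.
- apply/LfunyP; split => //; exists 0 => //.
  by apply: aeW => x; rewrite normr0.
- by apply/funext => x /=; rewrite addr0.
Qed.

Lemma ae_bounded_L1Loo c f : measurable_fun setT f -> ae_bounded c f -> V f.
Proof.
move=> mf fc; exists (cst 0), f; split.
- apply/Lfun1P; split => //; rewrite /norm1.
  by under eq_integral do rewrite normr0; rewrite integral0.
- apply/LfunyP; split => //; exists `|c| => //.
  by apply: filterS fc => x /le_trans; apply; exact: ler_norm.
- by apply/funext => x /=; rewrite add0r.
Qed.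

Lemma integrable1_lin c f g : integrable1 f -> integrable1 g ->
  integrable1 (fun x => c * f x + g x).
Proof.
rewrite !integrable1P => fi gi.
have := integrableD measurableT (integrableZl measurableT c fi) gi.
by apply: eq_integrable => // x _ /=; rewrite EFinD EFinM.
Qed.

Lemma ae_bounded_lin a b c f g : ae_bounded a f -> ae_bounded b g ->
  ae_bounded (`|c| * a + b) (fun x => c * f x + g x).
Proof.
apply: filterS2 => x fa gb; rewrite (le_trans (ler_normD _ _))// lerD//.
by rewrite normrM ler_wpM2l.
Qed.

Lemma L1Loo_measurable f : V f -> measurable_fun setT f.
Proof.
by move=> [g [h [/Lfun1P[mg _] /LfunyP[mh _] ->]]]; exact: measurable_funD.
Qed.

Lemma measurable_lin c f g : measurable_fun setT f -> measurable_fun setT g ->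
  measurable_fun setT (fun x => c * f x + g x).
Proof. by move=> mf mg; apply: measurable_funD => //; exact: measurable_funM. Qed.

Lemma L1Loo_lin c f g : V f -> V g -> V (fun x => c * f x + g x).
Proof.
move=> [f1 [f2 [/Lfun1P f1i /LfunyP[mf2 [a a0 f2a]] ->]]].
move=> [g1 [g2 [/Lfun1P g1i /LfunyP[mg2 [b b0 g2b]] ->]]].
exists (fun x => c * f1 x + g1 x), (fun x => c * f2 x + g2 x); split.
- exact/Lfun1P/integrable1_lin.
- apply/LfunyP; split; first exact: measurable_lin.
  by exists (`|c| * a + b); [rewrite addr_ge0// mulr_ge0|exact: ae_bounded_lin].
- by apply/funext => x /=; ring.
Qed.

Lemma L1LooD f g : V f -> V g -> V (fun x => f x + g x).
Proof.
move=> Vf Vg; rewrite (_ : (fun _ => _) = (fun x => 1 * f x + g x)).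
  exact: L1Loo_lin.
by apply/funext => x; rewrite mul1r.
Qed.

Lemma L1LooB f g : V f -> V g -> V (fun x => f x - g x).
Proof.
move=> Vf Vg; rewrite (_ : (fun _ => _) = (fun x => -1 * g x + f x)).
  exact: L1Loo_lin.
by apply/funext => x; rewrite mulN1r addrC.
Qed.

Lemma L1Loo_cst c : V (cst c).
Proof. by apply: (@ae_bounded_L1Loo `|c|) => //; exact: aeW. Qed.

Lemma L1LooZ c f : V f -> V (fun x => c * f x).
Proof.
move=> Vf; rewrite (_ : (fun _ => _) = (fun x => c * f x + cst 0 x)).
  by apply: L1Loo_lin => //; exact: L1Loo_cst.
by apply/funext => x; rewrite addr0.
Qed.

Lemma L1Loo_sum n (F : nat -> T -> R) : (forall k, V (F k)) ->
  V (fun x => \sum_(k < n) F k x).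
Proof.
move=> VF; elim: n => [|n ih].
  under eq_fun do rewrite big_ord0; exact: L1Loo_cst.
under eq_fun do rewrite big_ord_recr; exact: L1LooD.
Qed.

Lemma le_integrable1 f g : measurable_fun setT f -> integrable1 g ->
  (\forall x \ae mu, `|f x| <= `|g x|) -> integrable1 f.
Proof.
move=> mf [mg g1] fg; split => //; apply: le_lt_trans g1.
by apply: ge0_le_integral_ae => //; exact: measurableT_comp.
Qed.

Lemma norm1D f g : measurable_fun setT f -> measurable_fun setT g ->
  (norm1 (fun x => f x + g x)%R <= norm1 f + norm1 g)%E.
Proof.
move=> mf mg; rewrite /norm1 -ge0_integralD//; last 2 first.
- by apply/measurable_EFinP; exact: measurableT_comp.
- by apply/measurable_EFinP; exact: measurableT_comp.
under [leRHS]eq_integral do rewrite -EFinD.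
apply: ge0_le_integral_ae => //.
- by apply: measurableT_comp => //; exact: measurable_funD.
- by apply: measurable_funD => //; exact: measurableT_comp.
- by apply: aeW => x; exact: ler_normD.
Qed.

Lemma norm1Z c f : measurable_fun setT f ->
  norm1 (fun x => c * f x) = (`|c|%:E * norm1 f)%E.
Proof.
move=> mf; rewrite /norm1 -ge0_integralZl_EFin//; last first.
  by apply/measurable_EFinP; exact: measurableT_comp.
by apply: eq_integral => x _; rewrite normrM EFinM.
Qed.

End function_spaces.

(** * Elementary theory of Dunford-Schwartz operators *)

Section DS_theory.
Context {d : measure_display} {T : measurableType d} {R : realType}.
Variable mu : {measure set T -> \bar R}.
Implicit Types (f g h : T -> R) (c t : R) (S : (T -> R) -> (T -> R)).
Local Notation V := (L1_plus_Loo mu).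

(** Spares every later construction of an operator from handling [Lnorm]: the two contraction
    properties become statements on [norm1] and on explicit essential bounds. *)
Lemma DSI S :
  (forall f, V f -> V (S f)) ->
  (forall f g, V f -> V g -> (\forall x \ae mu, f x = g x) ->
    \forall x \ae mu, S f x = S g x) ->
  (forall c f g, V f -> V g ->
    \forall x \ae mu, S (fun y => c * f y + g y) x = c * S f x + S g x) ->
  (forall f, integrable1 mu f -> (norm1 mu (S f) <= norm1 mu f)%E) ->
  (forall c f, measurable_fun setT f -> 0 <= c -> ae_bounded mu c f ->
    ae_bounded mu c (S f)) -> DS mu S.
Proof.
move=> SV Sae Slin S1 Soo; split => //.
- move=> f g Vf Vg fg; have := Sae _ _ Vf Vg.
  have /[swap]/[apply] : \forall x \ae mu, f x = g x.
    by apply: filterS fg => x; exact.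
  by apply: filterS => x.
- by move=> c f g Vf Vg; apply: filterS (Slin c _ _ Vf Vg) => x.
- move=> f /Lfun1P f1.
  rewrite !Lnorm1; exact: S1.
- move=> f /[dup] /LfunyP[mf _].
  move: (Lnorm_ge0 mu +oo%E (EFin \o f)).
  case E : ('N[mu]_+oo[EFin \o f])%E => [c| |]; rewrite ?leey//.
  rewrite lee_fin => c0 _; apply/Lnormy_le => //; apply: Soo => //.
  by apply/Lnormy_le => //; rewrite E.
Qed.

Section basics.
Variable S : (T -> R) -> (T -> R).
Hypothesis DSS : DS mu S.

Lemma DS_L1Loo f : V f -> V (S f). Proof. exact: (DS_stable DSS). Qed.

Lemma DS_measurable f : V f -> measurable_fun setT (S f).
Proof. by move=> /DS_L1Loo; exact: L1Loo_measurable. Qed.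

Lemma DS_eq f g : V f -> V g -> (\forall x \ae mu, f x = g x) ->
  \forall x \ae mu, S f x = S g x.
Proof.
move=> Vf Vg fg; have : f = g %[ae mu] by apply: filterS fg => x ->.
by move=> /(DS_ae DSS Vf Vg); apply: filterS => x; exact.
Qed.

Lemma DS_lin c f g : V f -> V g ->
  \forall x \ae mu, S (fun y => c * f y + g y) x = c * S f x + S g x.
Proof.
by move=> Vf Vg; apply: filterS (DS_linear DSS c Vf Vg) => x; exact.
Qed.

Lemma DSD f g : V f -> V g ->
  \forall x \ae mu, S (fun y => f y + g y) x = S f x + S g x.
Proof.
move=> Vf Vg; have := DS_lin 1 Vf Vg.
have -> : (fun y => 1 * f y + g y) = (fun y => f y + g y).
  by apply/funext => y; rewrite mul1r.
by apply: filterS => x ->; rewrite mul1r.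
Qed.

Lemma DSB f g : V f -> V g ->
  \forall x \ae mu, S (fun y => f y - g y) x = S f x - S g x.
Proof.
move=> Vf Vg; have := DS_lin (-1) Vg Vf.
have -> : (fun y => -1 * g y + f y) = (fun y => f y - g y).
  by apply/funext => y; rewrite mulN1r addrC.
by apply: filterS => x ->; rewrite mulN1r addrC.
Qed.

Lemma DS0 : \forall x \ae mu, S (cst 0) x = 0.
Proof.
have V0 : V (cst 0) by exact: L1Loo_cst.
have := DSB V0 V0.
have -> : (fun y : T => cst 0 y - cst 0 y : R) = cst 0.
  by apply/funext => y /=; rewrite subrr.
by apply: filterS => x ->; rewrite subrr.
Qed.

Lemma DSZ c f : V f ->
  \forall x \ae mu, S (fun y => c * f y) x = c * S f x.
Proof.
move=> Vf; have := DS_lin c Vf (L1Loo_cst mu 0).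
have -> : (fun y => c * f y + cst 0 y) = (fun y => c * f y).
  by apply/funext => y; rewrite addr0.
by apply: filterS2 DS0 => x -> ->; rewrite addr0.
Qed.

Lemma DS_bigsum n (F : nat -> T -> R) : (forall k, V (F k)) ->
  \forall x \ae mu, S (fun y => \sum_(k < n) F k y) x = \sum_(k < n) S (F k) x.
Proof.
move=> VF; elim: n => [|n ih].
  have -> : (fun y : T => \sum_(k < 0) F k y) = cst 0.
    by apply/funext => y; rewrite big_ord0.
  by apply: filterS DS0 => x; rewrite big_ord0.
have -> : (fun y : T => \sum_(k < n.+1) F k y) =
    (fun y => \sum_(k < n) F k y + F n y).
  by apply/funext => y; rewrite big_ord_recr.
apply: filterS2 ih (DSD (L1Loo_sum n VF) (VF n)) => x ih ->.
by rewrite ih big_ord_recr.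
Qed.

Lemma DS_norm1 f : integrable1 mu f -> (norm1 mu (S f) <= norm1 mu f)%E.
Proof. by move=> /Lfun1P/(DS_L1 DSS); rewrite !Lnorm1. Qed.

Lemma DS_integrable1 f : integrable1 mu f -> integrable1 mu (S f).
Proof.
move=> fi; split; first exact/DS_measurable/integrable1_L1Loo.
by rewrite (le_lt_trans (DS_norm1 fi)); case: fi.
Qed.

Lemma DS_bounded c f : measurable_fun setT f -> 0 <= c ->
  ae_bounded mu c f -> ae_bounded mu c (S f).
Proof.
move=> mf c0 fc; apply/Lnormy_le => //.
have fL : f \in Lfun mu +oo%E by apply/LfunyP; split => //; exists c.
by rewrite (le_trans (DS_Loo DSS fL))//; exact/Lnormy_le.
Qed.

(** With [f = lo + hi] and [|lo| <= t], the image of [lo] stays below [t], so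
    [(|S f| - t)^+ <= |S hi|] almost everywhere; and [norm1 mu hi] is exactly [excess mu t f]. *)
Lemma DS_excess t f : 0 <= t -> V f -> (excess mu t (S f) <= excess mu t f)%E.
Proof.
move=> t0 Vf; have mf := L1Loo_measurable Vf.
pose lo x := trunc t (f x); pose hi x := f x - lo x.
have mlo : measurable_fun setT lo.
  exact: (@measurable_trunc _ _ _ (cst t)).
have mhi : measurable_fun setT hi by exact: measurable_funB.
have hiE : norm1 mu hi = excess mu t f.
  by apply: eq_integral => x _; rewrite trunc_rest.
have [foo|] := ltP (excess mu t f) +oo%E; last first.
  by rewrite leye_eq => /eqP ->; rewrite leey.
have hi1 : integrable1 mu hi by split => //; rewrite hiE.
have lo_bd : ae_bounded mu t lo by apply: aeW => x; exact: trunc_bound.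
have Vlo := ae_bounded_L1Loo mlo lo_bd.
rewrite -hiE (le_trans _ (DS_norm1 hi1))//; apply: ge0_le_integral_ae.
- exact/measurable_excess/DS_measurable.
- by apply: measurableT_comp => //; exact/DS_measurable/integrable1_L1Loo.
- by move=> x; rewrite le_max lexx orbT.
- by [].
have := DSD Vlo (integrable1_L1Loo hi1).
have -> : (fun y => lo y + hi y) = f by apply/funext => y; rewrite /hi subrKC.
apply: filterS2 (DS_bounded mlo t0 lo_bd) => x hlo ->.
rewrite ge_max normr_ge0 andbT lerBlDl (le_trans (ler_normD _ _))//.
by rewrite lerD2r.
Qed.

End basics.

Lemma DS_id : DS mu id.
Proof. by apply: DSI => // c f g _ _; exact: aeW. Qed.

Lemma DS_comp S1 S2 : DS mu S1 -> DS mu S2 -> DS mu (S1 \o S2).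
Proof.
move=> D1 D2; apply: DSI => /=.
- by move=> f Vf; do 2 apply: DS_L1Loo => //.
- move=> f g Vf Vg fg; apply: (DS_eq D1); [exact: DS_L1Loo..|exact: DS_eq].
- move=> c f g Vf Vg.
  have V1 := DS_L1Loo D2 Vf; have V2 := DS_L1Loo D2 Vg.
  have := DS_eq D1 (DS_L1Loo D2 (L1Loo_lin c Vf Vg)) (L1Loo_lin c V1 V2)
    (DS_lin D2 c Vf Vg).
  by apply: filterS2 (DS_lin D1 c V1 V2) => x <- ->.
- move=> f fi; rewrite (le_trans (DS_norm1 D1 (DS_integrable1 D2 fi)))//.
  exact: DS_norm1.
- move=> c f mf c0 fc; apply: DS_bounded => //; last exact: DS_bounded.
  by apply: (DS_measurable D2); exact: ae_bounded_L1Loo fc.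
Qed.

Lemma DS_iter S n : DS mu S -> DS mu (iter n S).
Proof.
move=> DSS; elim: n => [|n ih]; first exact: DS_id.
exact: (DS_comp DSS ih).
Qed.

Lemma norm_mean_le n (a : nat -> R) c : 0 <= c ->
  (forall k, (k < n)%N -> `|a k| <= c) -> `|n%:R^-1 * \sum_(k < n) a k| <= c.
Proof.
move=> c0 ac; case: n ac => [_|n ac].
  by rewrite invr0 mul0r normr0.
rewrite normrM ger0_norm// ler_pdivrMl// (le_trans (ler_norm_sum _ _ _))//.
rewrite (le_trans (ler_sum _ (G := fun=> c) _))//; first by move=> i _; exact: ac.
by rewrite sumr_const card_ord mulr_natl.
Qed.

Lemma norm1_sum n (F : nat -> T -> R) (C : \bar R) :
  (forall k, measurable_fun setT (F k)) -> (forall k, (norm1 mu (F k) <= C)%E) ->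
  (norm1 mu (fun x => \sum_(k < n) F k x)%R <= n%:R%:E * C)%E.
Proof.
move=> mF FC; elim: n => [|n ih].
  rewrite mul0e /norm1; under eq_integral do rewrite big_ord0 normr0.
  by rewrite integral0.
under eq_fun do rewrite big_ord_recr/=.
rewrite (le_trans (norm1D _ _ _))//; first exact: measurable_sum.
rewrite -natr1 EFinD ge0_muleDl// mul1e; exact: leeD.
Qed.

(** Facts about one operator now apply to averages, and to averages of averages. *)
Lemma DS_average S n : DS mu S -> DS mu (average S n).
Proof.
move=> DSS; have DSk k := DS_iter k DSS.
have Vk f k : V f -> V (iter k S f) by exact: DS_L1Loo.
apply: DSI.
- by move=> f Vf; apply/L1LooZ/L1Loo_sum => k; exact: Vk.
- move=> f g Vf Vg fg.
  have /ae_foralln : forall k, \forall x \ae mu, iter k S f x = iter k S g x.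
    by move=> k; exact: DS_eq.
  by apply: filterS => x h; congr (_ * _); apply: eq_bigr => i _; exact: h.
- move=> c f g Vf Vg.
  have /ae_foralln : forall k, \forall x \ae mu,
      iter k S (fun y => c * f y + g y) x = c * iter k S f x + iter k S g x.
    by move=> k; exact: DS_lin.
  apply: filterS => x h; rewrite /average mulrCA -mulrDr [c * _]mulr_sumr -big_split/=.
  by congr (_ * _); apply: eq_bigr => i _; exact: h.
- move=> f fi.
  have mk k : measurable_fun setT (iter k S f).
    exact/L1Loo_measurable/Vk/integrable1_L1Loo.
  rewrite norm1Z; last exact: measurable_sum.
  case: n => [|n]; first by rewrite invr0 normr0 mul0e norm1_ge0.
  rewrite ger0_norm// lee_pdivrMl//.
  apply: norm1_sum => // k; exact: (DS_norm1 (DSk k)).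
- move=> c f mf c0 fc.
  have /ae_foralln : forall k, ae_bounded mu c (iter k S f).
    by move=> k; exact: (DS_bounded (DSk k)).
  by apply: filterS => x h; apply: (norm_mean_le (a := fun k => iter k S f x)).
Qed.

End DS_theory.

(** * The maximal inequality *)

Lemma measure_bigcup_le d (T : measurableType d) (R : realType)
    (mu : {measure set T -> \bar R}) (F : (set T)^nat) (C : \bar R) :
  (forall n, measurable (F n)) -> nondecreasing_seq F ->
  (forall n, (mu (F n) <= C)%E) -> (mu (\bigcup_n F n) <= C)%E.
Proof.
move=> mF ndF FC.
have mU : measurable (\bigcup_n F n) by exact: bigcup_measurable.
have h : mu (F n) @[n --> \oo] --> mu (\bigcup_n F n).
  exact: nondecreasing_cvg_mu.
rewrite -(cvg_lim _ h)//; apply: lime_le; first by apply/cvg_ex; eexists; exact: h.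
by apply: nearW => n /=.
Qed.

Section maximal_inequality.
Context {d : measure_display} {T : measurableType d} {R : realType}.
Variable mu : {measure set T -> \bar R}.
Variables (S : (T -> R) -> (T -> R)) (f : T -> R) (a : R).
Hypotheses (DSS : DS mu S) (f1 : integrable1 mu f) (a0 : 0 < a).

(* Chacon's filling scheme. [filling n] is the capacity left free at each point
   below the level [a], and the mass still to be placed: a point absorbs what it
   can of the mass found there, and [S] transports the rest. Whenever some
   average of [f] exceeds [a] at a point, the capacity of that point has been
   used up. *)
Fixpoint filling (n : nat) : (T -> R) * (T -> R) :=
  if n is m.+1 then
    let: (c, e) := filling m in
    (fun x => c x - `|trunc (c x) (e x)|, S (fun x => e x - trunc (c x) (e x)))
  else (cst a, f).

Let cap n := (filling n).1.
Let mass n := (filling n).2.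
Let fill n x := trunc (cap n x) (mass n x).
Let rest n x := mass n x - fill n x.

Let capS n x : cap n.+1 x = cap n x - `|fill n x|.
Proof. by rewrite /fill /cap /mass/=; case: (filling n). Qed.

Let massS n : mass n.+1 = S (rest n).
Proof. by rewrite /rest /fill /cap /mass/=; case: (filling n). Qed.

Let cap_ge0 n x : 0 <= cap n x.
Proof.
elim: n => [|n ih]; first exact: ltW.
by rewrite capS subr_ge0 trunc_bound.
Qed.

Let capE n x : cap n x = a - \sum_(k < n) `|fill k x|.
Proof.
elim: n => [|n ih]; first by rewrite big_ord0 subr0.
by rewrite capS ih big_ord_recr opprD addrA.
Qed.

Let cap_mono m n x : (m <= n)%N -> cap n x <= cap m x.
Proof.
elim: n => [|n ih]; first by rewrite leqn0 => /eqP ->.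
rewrite leq_eqVlt => /orP[/eqP -> //|/ih]; apply: le_trans.
by rewrite capS gerBl.
Qed.

Let sum_fill_bound n x : `|\sum_(k < n) fill k x| <= a.
Proof.
rewrite (le_trans (ler_norm_sum _ _ _))//.
by have := cap_ge0 n x; rewrite capE subr_ge0.
Qed.

(** Capacity that is still positive later means that step [k] did not use it up; then the truncation
    was the identity and all the mass was absorbed. *)
Let rest_eq0 n k x : (k < n)%N -> 0 < cap n x -> rest k x = 0.
Proof.
move=> kn cn; have := lt_le_trans cn (cap_mono x kn).
by rewrite capS subr_gt0 => /trunc_id h; rewrite /rest /fill h subrr.
Qed.

Let rest_fill n x : `|rest n x| + `|fill n x| = `|mass n x|.
Proof. exact: trunc_split. Qed.

Let filling_meas n : measurable_fun setT (cap n) /\ integrable1 mu (mass n).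
Proof.
elim: n => [|n [mc me]]; first by split.
have mfill : measurable_fun setT (fill n).
  by apply: measurable_trunc => //; case: me.
split.
  have -> : cap n.+1 = (fun x => cap n x - `|fill n x|) by apply/funext => x.
  by apply: measurable_funB => //; exact: measurableT_comp.
rewrite massS; apply: DS_integrable1 => //; apply: (le_integrable1 _ me).
  by apply: measurable_funB => //; case: me.
by apply: aeW => x; rewrite -rest_fill lerDl.
Qed.

Let mass_int n : integrable1 mu (mass n). Proof. by case: (filling_meas n). Qed.

Let fill_meas n : measurable_fun setT (fill n).
Proof.
by case: (filling_meas n) => mc [me _]; exact: measurable_trunc.
Qed.

Let rest_int n : integrable1 mu (rest n).
Proof.
apply: (le_integrable1 _ (mass_int n)).
  by apply: measurable_funB => //; case: (mass_int n).
by apply: aeW => x; rewrite -rest_fill lerDl.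
Qed.

Let fill_rest_norm1 n :
  (norm1 mu (fill n) + norm1 mu (rest n) = norm1 mu (mass n))%E.
Proof.
rewrite /norm1 -ge0_integralD//; last 2 first.
- by apply/measurable_EFinP; exact: measurableT_comp.
- by apply/measurable_EFinP; apply: measurableT_comp => //; case: (rest_int n).
by apply: eq_integral => x _; rewrite -EFinD addrC rest_fill.
Qed.

(** Conservation of mass: each step splits the mass into an absorbed part and a rest, and
    transporting the rest by [S] does not increase its norm. *)
Let sum_fill_norm1 n :
  (\sum_(k < n) norm1 mu (fill k) + norm1 mu (mass n) <= norm1 mu f)%E.
Proof.
elim: n => [|n ih]; first by rewrite big_ord0 add0e.
apply: le_trans ih; rewrite big_ord_recr/= -addeA; apply: leeD2l.
by rewrite -(fill_rest_norm1 n); apply: leeD2l; rewrite massS; exact: DS_norm1.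
Qed.

(** By [capE] an exhausted point has absorbed a total of at least [a], so this is Chebyshev's
    inequality for the sum of the [|fill k|]. *)
Let exhausted_measure n :
  (a%:E * mu [set x | (cap n x <= 0)%R] <= norm1 mu f)%E.
Proof.
have mcap : measurable_fun setT (cap n) by case: (filling_meas n).
have mZ : measurable [set x | cap n x <= 0].
  by apply: measurable_setler.
have := sum_fill_norm1 n; apply: le_trans.
rewrite -(@adde0 _ (_ * _)%E) leeD ?norm1_ge0//.
rewrite /norm1 -ge0_integral_sum//; last first.
  by move=> k; apply/measurable_EFinP; exact: measurableT_comp.
rewrite -integral_cst// integral_mkcond.
under [leRHS]eq_integral do rewrite sumEFin.
apply: ge0_le_integral => //.
- by move=> x _; apply: erestrict_ge0 => y _; rewrite /= lee_fin ltW.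
- by apply/(measurable_restrictT _ mZ).1.
- by apply/measurable_EFinP/measurable_sum => k; exact: measurableT_comp.
move=> x _; rewrite patchE; case: ifPn => [|_]; last first.
  by rewrite lee_fin sumr_ge0.
by rewrite inE/= lee_fin capE subr_le0.
Qed.

(** Let [D n] be the difference to be bounded. From [mass 0 = f] and [mass k.+1 = S (rest k)]
    follows [D n.+1 = \sum_(k < n.+1) fill k + S (D n)]. The sum is at most [a] in modulus, and [S]
    preserves the bound on [D n]. *)
Let partial_sums_bound n : ae_bounded mu (n%:R * a)
  (fun x => \sum_(k < n) iter k S f x - \sum_(k < n) rest k x).
Proof.
have Vf k : L1_plus_Loo mu (iter k S f).
  exact/(DS_L1Loo (DS_iter k DSS))/integrable1_L1Loo.
have Vr k : L1_plus_Loo mu (rest k) by exact: integrable1_L1Loo.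
elim: n => [|n ih].
  by apply: aeW => x; rewrite !big_ord0 subr0 normr0 mul0r.
have VA := L1Loo_sum n Vf; have VD := L1Loo_sum n Vr.
have VAD := L1LooB VA VD.
have hS := DS_bounded DSS (L1Loo_measurable VAD) (mulr_ge0 (ler0n _ n) (ltW a0)) ih.
apply: filterS2 hS (filterI (DSB DSS VA VD)
  (filterI (DS_bigsum DSS n Vf) (DS_bigsum DSS n Vr))) => x h [E1 [E2 E3]].
move: h; rewrite E1 E2 E3 => h {E1 E2 E3}.
have -> : \sum_(k < n.+1) iter k S f x - \sum_(k < n.+1) rest k x =
    \sum_(k < n.+1) fill k x +
    (\sum_(k < n) S (iter k S f) x - \sum_(k < n) S (rest k) x).
  have : \sum_(k < n.+1) rest k x =
      \sum_(k < n.+1) mass k x - \sum_(k < n.+1) fill k x.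
    by rewrite -sumrB.
  move=> ->; rewrite big_ord_recl/= [\sum_(k < n.+1) mass k x]big_ord_recl/=.
  have -> : \sum_(i < n) mass (bump 0 i) x = \sum_(k < n) S (rest k) x.
    by apply: eq_bigr => i _; rewrite -massS.
  have -> : mass 0 x = f x by [].
  under eq_bigr do rewrite add0n.
  ring.
rewrite -natr1 mulrDl mul1r (le_trans (ler_normD _ _))//.
by rewrite [leRHS]addrC lerD.
Qed.

Lemma maximal_inequality :
  (a%:E * mu (\bigcup_n [set x | (a < `|average S n f x|)%R]) <= norm1 mu f)%E.
Proof.
have Vf := integrable1_L1Loo f1.
have mav n : measurable_fun setT (average S n f).
  exact: (DS_measurable (DS_average n DSS)).
have mZ n : measurable [set x | cap n x <= 0].
  have [mcap _] := filling_meas n.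
  by apply: measurable_setler.
rewrite -lee_pdivlMl//.
apply: (@le_trans _ _ (mu (\bigcup_n [set x | cap n x <= 0]))).
  apply: le_measure_ae.
  - by apply: bigcup_measurable => n _; exact: measurable_setgt.
  - exact: bigcup_measurable.
  (* Where capacity is left after [n] steps, all [rest k] with [k < n] vanish, and the bound on
     partial sums leaves [|average S n f x| <= a]. *)
  have /ae_foralln := partial_sums_bound; apply: filterS => x h [n _ /= an].
  exists n => //=; rewrite leNgt; apply/negP => cn.
  have := h n; rewrite [X in _ - X]big1 => [|k _]; last first.
    by rewrite (rest_eq0 _ cn).
  rewrite subr0; case: n an {cn} => [|n] an.
    by move: an; rewrite /average invr0 mul0r normr0 ltNge ltW.
  move: an; rewrite /average normrM ger0_norm// ltr_pdivlMl//.
  by move=> /lt_le_trans/[apply]; rewrite ltxx.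
apply: measure_bigcup_le => //.
  move=> m n mn; apply/subsetPset => x /=; apply: le_trans; exact: cap_mono.
by move=> n; rewrite lee_pdivlMl//; exact: exhausted_measure.
Qed.

End maximal_inequality.

(** * Convergence of the averages *)

Section square_norm.
Context {d : measure_display} {T : measurableType d} {R : realType}.
Variable mu : {measure set T -> \bar R}.
Implicit Types (f g : T -> R) (c t h M : R) (S : (T -> R) -> (T -> R)).
Local Notation V := (L1_plus_Loo mu).

Lemma sum_excess n c (e : nat -> R) f : measurable_fun setT f -> 0 <= c ->
  (\int[mu]_x (\sum_(k < n) c * Num.max (`|f x| - e k) 0)%:E =
   \sum_(k < n) c%:E * excess mu (e k) f)%E.
Proof.
move=> mf c0; under eq_integral do rewrite -sumEFin.
rewrite ge0_integral_sum//; last 2 first.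
- move=> k; apply/measurable_EFinP/measurable_funM => //.
  exact: measurable_excess.
- by move=> k x _; rewrite lee_fin mulr_ge0// le_max lexx orbT.
apply: eq_bigr => k _; under eq_integral do rewrite EFinM.
rewrite ge0_integralZl_EFin//.
- by move=> x _; rewrite lee_fin le_max lexx orbT.
- by apply/measurable_EFinP; exact: measurable_excess.
Qed.

Lemma measurable_sqr f : measurable_fun setT f ->
  measurable_fun setT (fun x => f x ^+ 2).
Proof. exact: measurable_funX. Qed.

Lemma measurable_layers n c (e : nat -> R) f : measurable_fun setT f ->
  measurable_fun setT (fun x => \sum_(k < n) c * Num.max (`|f x| - e k) 0).
Proof.
move=> mf; apply: measurable_sum => k; apply: measurable_funM => //.
exact: measurable_excess.
Qed.

Lemma layers_ge0 n c (e : nat -> R) f x : 0 <= c ->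
  0 <= \sum_(k < n) c * Num.max (`|f x| - e k) 0.
Proof.
by move=> c0; apply: sumr_ge0 => k _; rewrite mulr_ge0// le_max lexx orbT.
Qed.

Lemma square_norm_le M f : integrable1 mu f -> 0 <= M -> ae_bounded mu M f ->
  (square_norm mu f <= M%:E * norm1 mu f)%E.
Proof.
move=> [mf f1] M0 fM; rewrite /norm1 -ge0_integralZl_EFin//; last first.
  by apply/measurable_EFinP; exact: measurableT_comp.
under [leRHS]eq_integral do rewrite -EFinM.
apply: ge0_le_integral_ae.
- exact: measurable_sqr.
- by apply: measurable_funM => //; exact: measurableT_comp.
- by move=> x; exact: sqr_ge0.
- by move=> x; exact: mulr_ge0.
by apply: filterS fM => x fM; rewrite -real_normK ?num_real// expr2 ler_wpM2r.
Qed.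

(* The square norm is, up to [2 h |f|_1], a positive combination of the
   functionals [excess], and these do not increase under [S]. *)
Lemma DS_square_norm S M f : DS mu S -> integrable1 mu f -> 0 <= M ->
  ae_bounded mu M f -> (square_norm mu (S f) <= square_norm mu f)%E.
Proof.
move=> DSS fi M0 fM; have Vf := integrable1_L1Loo fi.
have [mf f1] := fi.
have mSf := DS_measurable DSS Vf.
have SfM := DS_bounded DSS mf M0 fM.
(* The [n] layers of thickness [h] reach up to the bound [M], so the remainder in [layer_sum_ge]
   vanishes. *)
have step h n : 0 <= h -> M <= n%:R * h ->
    (square_norm mu (S f) <= square_norm mu f + (2 * h)%:E * norm1 mu f)%E.
  move=> h0 hM; have h20 : 0 <= 2 * h by rewrite mulr_ge0.
  pose e k : R := k%:R * h.
  have e0 k : 0 <= e k by rewrite mulr_ge0.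
  apply: (@le_trans _ _ (\sum_(k < n) (2 * h)%:E * excess mu (e k) (S f))%E).
    rewrite -sum_excess//; apply: ge0_le_integral_ae.
    - exact: measurable_sqr.
    - exact: measurable_layers.
    - by move=> x; exact: sqr_ge0.
    - by move=> x; exact: layers_ge0.
    apply: filterS SfM => x SfM; have := layer_sum_ge n h0 (normr_ge0 (S f x)).
    rewrite [X in _ - X ^+ 2](max_idPr _) ?expr0n/= ?subr0 ?real_normK ?num_real//.
    by rewrite subr_le0 (le_trans SfM).
  (* One more layer is added so that, once the layer [e 0 = 0] of size [2 * h * norm1 mu f] is split
     off, exactly the [n] right endpoints remain, whose sum lies below the square. *)
  apply: (@le_trans _ _ (\sum_(k < n.+1) (2 * h)%:E * excess mu (e k) f)%E).
    rewrite [leRHS]big_ord_recr/= -[leLHS]adde0 leeD//.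
      by apply: lee_sum => k _; rewrite lee_wpmul2l ?lee_fin// DS_excess.
    by rewrite mule_ge0 ?lee_fin ?excess_ge0.
  rewrite big_ord_recl/= /e mul0r excess0 addeC leeD2r//.
  rewrite -(@sum_excess n (2 * h) (fun k => k.+1%:R * h))//.
  apply: ge0_le_integral_ae.
  - exact: (@measurable_layers n (2 * h) (fun k => k.+1%:R * h)).
  - exact: measurable_sqr.
  - by move=> x; exact: (@layers_ge0 n (2 * h) (fun k => k.+1%:R * h)).
  - by move=> x; exact: sqr_ge0.
  apply: aeW => x; have := layer_sum_le n h0 (normr_ge0 (f x)).
  by rewrite real_normK ?num_real.
have Lfin : norm1 mu f \is a fin_num by rewrite ge0_fin_numE// norm1_ge0.
have L0 : 0 <= fine (norm1 mu f) by rewrite fine_ge0// norm1_ge0.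
apply/lee_addgt0Pr => e e0.
(* Makes the error [2 * h * norm1 mu f] at most [e]; the [+ 1] avoids dividing by zero. *)
pose h := e / (2 * (fine (norm1 mu f) + 1)).
have h0 : 0 < h by rewrite divr_gt0// mulr_gt0// ltr_wpDl.
have [n Mn] : exists n, M <= n%:R * h.
  exists (Num.bound (M / h)); rewrite -ler_pdivrMr//.
  by rewrite ltW// archi_boundP// divr_ge0// ltW.
rewrite (le_trans (step h n (ltW h0) Mn))// leeD2l// -(fineK Lfin) -EFinM lee_fin.
rewrite /h; move: L0; set L := fine _ => L0.
have -> : 2 * (e / (2 * (L + 1))) * L = e * (L / (L + 1)) by field; lra.
by rewrite ler_piMr ?ltW// ltr_pdivrMr ?mul1r; lra.
Qed.

End square_norm.

(** * Square norms of integrable bounded functions *)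

Section mean_ergodic.
Context {d : measure_display} {T : measurableType d} {R : realType}.
Variable mu : {measure set T -> \bar R}.
Implicit Types (f g : T -> R) (c t M : R) (S : (T -> R) -> (T -> R)).
Local Notation V := (L1_plus_Loo mu).

Definition integrable_bounded f :=
  integrable1 mu f /\ exists2 M, 0 <= M & ae_bounded mu M f.

Local Notation IB := integrable_bounded.
Local Notation sq f := (fine (square_norm mu f)).
Local Notation n1 f := (fine (norm1 mu f)).

Lemma IB_measurable f : IB f -> measurable_fun setT f.
Proof. by case=> -[]. Qed.

Lemma IB_L1Loo f : IB f -> V f.
Proof. by case=> /integrable1_L1Loo. Qed.

Lemma IB_lin c f g : IB f -> IB g -> IB (fun x => c * f x + g x).
Proof.
move=> [fi [a a0 fa]] [gi [b b0 gb]]; split; first exact: integrable1_lin.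
exists (`|c| * a + b); first by rewrite addr_ge0// mulr_ge0.
exact: ae_bounded_lin.
Qed.

Lemma IBD f g : IB f -> IB g -> IB (fun x => f x + g x).
Proof.
move=> If Ig; rewrite (_ : (fun _ => _) = (fun x => 1 * f x + g x)).
  exact: IB_lin.
by apply/funext => x; rewrite mul1r.
Qed.

Lemma IBB f g : IB f -> IB g -> IB (fun x => f x - g x).
Proof.
move=> If Ig; rewrite (_ : (fun _ => _) = (fun x => -1 * g x + f x)).
  exact: IB_lin.
by apply/funext => x; rewrite mulN1r addrC.
Qed.

Lemma IBZ c f : IB f -> IB (fun x => c * f x).
Proof.
move=> If; rewrite (_ : (fun _ => _) = (fun x => (c - 1) * f x + f x)).
  exact: IB_lin.
by apply/funext => x; ring.
Qed.

Lemma DS_IB S f : DS mu S -> IB f -> IB (S f).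
Proof.
move=> DSS [fi [M M0 fM]]; split; first exact: DS_integrable1.
by exists M => //; apply: DS_bounded => //; case: fi.
Qed.

Lemma norm1E f : integrable1 mu f -> norm1 mu f = (n1 f)%:E.
Proof. by case=> _ f1; rewrite fineK// ge0_fin_numE// norm1_ge0. Qed.

Lemma square_normE f : IB f -> square_norm mu f = (sq f)%:E.
Proof.
case=> fi [M M0 fM]; rewrite fineK// ge0_fin_numE ?square_norm_ge0//.
rewrite (le_lt_trans (square_norm_le fi M0 fM))// norm1E//.
by rewrite -EFinM ltry.
Qed.

Lemma n1_ge0 f : 0 <= n1 f.
Proof. by rewrite fine_ge0// norm1_ge0. Qed.

Lemma sq_ge0 f : 0 <= sq f.
Proof. by rewrite fine_ge0// square_norm_ge0. Qed.

Lemma n1D f g : integrable1 mu f -> integrable1 mu g ->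
  n1 (fun x => f x + g x) <= n1 f + n1 g.
Proof.
move=> fi gi; have [mf _] := fi; have [mg _] := gi.
have := norm1D mu mf mg; rewrite (norm1E fi) (norm1E gi) norm1E//.
have := integrable1_lin 1 fi gi; congr integrable1.
by apply/funext => x; rewrite mul1r.
Qed.

Lemma n1Z c f : integrable1 mu f -> n1 (fun x => c * f x) = `|c| * n1 f.
Proof.
by move=> fi; have [mf _] := fi; rewrite norm1Z// (norm1E fi) -EFinM.
Qed.

Lemma DS_n1 S f : DS mu S -> integrable1 mu f -> n1 (S f) <= n1 f.
Proof.
move=> DSS fi; have := DS_norm1 DSS fi.
by rewrite (norm1E fi) norm1E//; exact: DS_integrable1.
Qed.

Lemma DS_sq S f : DS mu S -> IB f -> sq (S f) <= sq f.
Proof.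
move=> DSS If; have [fi [M M0 fM]] := If.
have := DS_square_norm DSS fi M0 fM.
by rewrite (square_normE If) square_normE//; exact: DS_IB.
Qed.

Lemma sq2 f : IB f -> sq (fun x => 2 * f x) = 4 * sq f.
Proof.
move=> If; have If2 := IBZ 2 If.
apply: EFin_inj; rewrite EFinM -!square_normE// /square_norm.
rewrite -ge0_integralZl_EFin//.
- by apply: eq_integral => x _; rewrite -EFinM; congr EFin; ring.
- by move=> x _; rewrite lee_fin sqr_ge0.
- exact/measurable_EFinP/measurable_sqr/IB_measurable.
Qed.

Lemma parallelogram f g : IB f -> IB g ->
  sq (fun x => f x + g x) + sq (fun x => f x - g x) = 2 * sq f + 2 * sq g.
Proof.
move=> If Ig; have Ia := IBD If Ig; have Ib := IBB If Ig.
have ms h : IB h -> measurable_fun setT (EFin \o (fun x => h x ^+ 2)).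
  by move=> Ih; exact/measurable_EFinP/measurable_sqr/IB_measurable.
have s0 h (x : T) : setT x -> (0 <= (h x ^+ 2)%:E :> \bar R)%E.
  by rewrite lee_fin sqr_ge0.
apply: EFin_inj; rewrite !EFinD !EFinM -!square_normE// /square_norm.
rewrite -ge0_integralD//; try exact: ms; try exact: s0.
rewrite -!ge0_integralZl_EFin//; try exact: ms; try exact: s0.
rewrite -ge0_integralD//.
- by apply: eq_integral => x _; rewrite -!EFinM -!EFinD; congr EFin; ring.
- by move=> x _; rewrite mule_ge0// s0.
- by apply: measurable_funeM; exact: ms.
- by move=> x _; rewrite mule_ge0// s0.
- by apply: measurable_funeM; exact: ms.
Qed.

(** From [f^2 - g^2 = (f - g) (f + g)]: uniform closeness controls square norms without a triangle
    inequality for them. *)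
Lemma sq_close c f g : IB f -> IB g -> 0 <= c ->
  ae_bounded mu c (fun x => f x - g x) -> sq f <= sq g + c * (n1 f + n1 g).
Proof.
move=> If Ig c0 fgc; have [fi _] := If; have [gi _] := Ig.
have mf := IB_measurable If; have mg := IB_measurable Ig.
have mn (h : T -> R) : measurable_fun setT h ->
    measurable_fun setT (EFin \o (fun x => `|h x| : R)).
  by move=> mh; apply/measurable_EFinP; exact: measurableT_comp.
rewrite -lee_fin EFinD EFinM EFinD -!square_normE// -!norm1E//.
have -> : (norm1 mu f + norm1 mu g = \int[mu]_x (`|f x|%:E + `|g x|%:E))%E.
  by rewrite ge0_integralD//; exact: mn.
rewrite -ge0_integralZl_EFin//; last 2 first.
- by move=> x _; rewrite adde_ge0.
- by apply: emeasurable_funD; exact: mn.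
rewrite /square_norm -ge0_integralD//; last 4 first.
- by move=> x _; rewrite lee_fin sqr_ge0.
- exact/measurable_EFinP/measurable_sqr.
- by move=> x _; rewrite mule_ge0// adde_ge0.
- by apply: measurable_funeM; apply: emeasurable_funD; exact: mn.
rewrite [leRHS](_ : _ = \int[mu]_x (g x ^+ 2 + c * (`|f x| + `|g x|))%:E)%E;
  last by apply: eq_integral.
apply: ge0_le_integral_ae.
- exact: measurable_sqr.
- apply: measurable_funD; first exact: measurable_sqr.
  by apply: measurable_funM => //; apply: measurable_funD; exact: measurableT_comp.
- by move=> x; exact: sqr_ge0.
- by move=> x; rewrite addr_ge0 ?sqr_ge0// mulr_ge0// addr_ge0.
apply: filterS fgc => x fgc.
rewrite -lerBlDl subr_sqr (le_trans (ler_norm _))// normrM ler_pM//.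
exact: ler_normD.
Qed.

End mean_ergodic.

(** * Averages of averages, and the mean ergodic theorem *)

Section averages.
Context {d : measure_display} {T : measurableType d} {R : realType}.
Variable mu : {measure set T -> \bar R}.
Variable S : (T -> R) -> (T -> R).
Hypothesis DSS : DS mu S.
Implicit Types (f g b : T -> R) (c M : R).
Local Notation V := (L1_plus_Loo mu).
Local Notation IB := (integrable_bounded mu).
Local Notation sq f := (fine (square_norm mu f)).
Local Notation n1 f := (fine (norm1 mu f)).

Let Viter j f : V f -> V (iter j S f).
Proof. exact: (DS_L1Loo (DS_iter j DSS)). Qed.

Let Vav j f : V f -> V (average S j f).
Proof. exact: (DS_L1Loo (DS_average j DSS)). Qed.

Lemma mean_sub n (a : nat -> R) c : (0 < n)%N ->
  n%:R^-1 * \sum_(j < n) a j - c = n%:R^-1 * \sum_(j < n) (a j - c).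
Proof.
move=> n0; rewrite sumrB sumr_const card_ord mulrBr; congr (_ - _).
by rewrite -(mulr_natl c) mulKf// pnatr_eq0 -lt0n.
Qed.

Lemma average_shift n f x :
  average S n (S f) x - average S n f x = n%:R^-1 * (iter n S f x - f x).
Proof.
rewrite /average -mulrBr; congr (_ * _).
under eq_bigr do rewrite -iterSr.
elim: n => [|n ih]; first by rewrite !big_ord0 !subrr.
by rewrite !big_ord_recr/=; move: ih; lra.
Qed.

Lemma iter_bounded j M f : V f -> 0 <= M -> ae_bounded mu M f ->
  ae_bounded mu M (iter j S f).
Proof. by move=> Vf; exact: (DS_bounded (DS_iter j DSS) (L1Loo_measurable Vf)). Qed.

Lemma average_bounded j M f : V f -> 0 <= M -> ae_bounded mu M f ->
  ae_bounded mu M (average S j f).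
Proof.
by move=> Vf; exact: (DS_bounded (DS_average j DSS) (L1Loo_measurable Vf)).
Qed.

Lemma average_iter_close k j M f : V f -> 0 <= M -> ae_bounded mu M f ->
  ae_bounded mu (k%:R^-1 * (j%:R * (2 * M)))
    (fun x => average S k (iter j S f) x - average S k f x).
Proof.
move=> Vf M0 fM; elim: j => [|j ih].
  by apply: aeW => x; rewrite subrr normr0 mul0r mulr0.
apply: filterS2 ih (filterI (iter_bounded j Vf M0 fM)
  (iter_bounded k (Viter j Vf) M0 (iter_bounded j Vf M0 fM))).
move=> x ih [fj fk].
rewrite iterS -(subrKA (average S k (iter j S f) x)) average_shift.
have -> : k%:R^-1 * (j.+1%:R * (2 * M)) =
    k%:R^-1 * (2 * M) + k%:R^-1 * (j%:R * (2 * M)).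
  by rewrite -[j.+1%:R]natr1; ring.
rewrite (le_trans (ler_normD _ _))// lerD// normrM ger0_norm// ler_wpM2l//.
rewrite (le_trans (ler_normB _ _))//.
by rewrite mulrDl mul1r lerD.
Qed.

(** A long average forgets a preliminary short one: [average S k] changes by at most [2 M / k] each
    time [S] is applied to its argument, and [average S n f] is a mean of fewer than [n] such
    applications. *)
Lemma average_average_close k n M f : V f -> 0 <= M -> ae_bounded mu M f ->
  (0 < n)%N -> ae_bounded mu (k%:R^-1 * (n%:R * (2 * M)))
    (fun x => average S k (average S n f) x - average S k f x).
Proof.
move=> Vf M0 fM n0; have Dk := DS_average k DSS.
have Vit j : V (iter j S f) by exact: Viter.
have /ae_foralln hj := fun j => average_iter_close k j Vf M0 fM.
apply: filterS2 hj (filterI (DSZ Dk n%:R^-1 (L1Loo_sum n Vit))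
  (DS_bigsum Dk n Vit)) => x hj [E1 E2].
rewrite {2}/average E1 E2.
rewrite (mean_sub (fun j => average S k (iter j S f) x))//.
apply: (norm_mean_le (a := fun j => average S k (iter j S f) x - average S k f x)).
  by rewrite mulr_ge0// mulr_ge0// mulr_ge0.
move=> j jn; rewrite (le_trans (hj j))// ler_wpM2l// ler_wpM2r ?mulr_ge0//.
by rewrite ler_nat ltnW.
Qed.

Lemma almost_invariant_iter j c g : V g -> 0 <= c ->
  ae_bounded mu c (fun x => S g x - g x) ->
  ae_bounded mu (j%:R * c) (fun x => iter j S g x - g x).
Proof.
move=> Vg c0 gc; elim: j => [|j ih].
  by apply: aeW => x; rewrite subrr normr0 mul0r.
have VSg := L1LooB (DS_L1Loo DSS Vg) Vg.
have hj := iter_bounded j VSg c0 gc.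
apply: filterS2 ih (filterI hj (DSB (DS_iter j DSS) (DS_L1Loo DSS Vg) Vg)).
move=> x ih [+ E]; rewrite E -iterSr => hj'.
rewrite -(subrKA (iter j S g x)).
have -> : j.+1%:R * c = c + j%:R * c by rewrite -[j.+1%:R]natr1; ring.
by rewrite (le_trans (ler_normD _ _))// lerD.
Qed.

Lemma almost_invariant_average n c g : V g -> 0 <= c -> (0 < n)%N ->
  ae_bounded mu c (fun x => S g x - g x) ->
  ae_bounded mu (n%:R * c) (fun x => average S n g x - g x).
Proof.
move=> Vg c0 n0 gc.
have /ae_foralln := fun j => almost_invariant_iter j Vg c0 gc.
apply: filterS => x hj; rewrite /average.
rewrite (mean_sub (fun j => iter j S g x))//.
apply: (norm_mean_le (a := fun j => iter j S g x - g x)); first exact: mulr_ge0.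
by move=> j jn; rewrite (le_trans (hj j))// ler_wpM2r// ler_nat ltnW.
Qed.

(** [S] commutes with its averages almost everywhere, and the difference telescopes to
    [(S^n f - f) / n]. *)
Lemma average_almost_invariant n M f : V f -> 0 <= M -> ae_bounded mu M f ->
  ae_bounded mu (n%:R^-1 * (2 * M))
    (fun x => S (average S n f) x - average S n f x).
Proof.
move=> Vf M0 fM; have Vit j : V (iter j S f) by exact: Viter.
apply: filterS2 fM (filterI (iter_bounded n Vf M0 fM)
  (filterI (DSZ DSS n%:R^-1 (L1Loo_sum n Vit)) (DS_bigsum DSS n Vit))).
move=> x fM [fn [E1 E2]].
have -> : S (average S n f) x = average S n (S f) x.
  rewrite {1}/average E1 E2 /average; congr (_ * _).
  by apply: eq_bigr => j _; rewrite -iterSr.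
rewrite average_shift normrM ger0_norm// ler_wpM2l//.
by rewrite (le_trans (ler_normB _ _))// mulr2n mulrDl mul1r lerD.
Qed.

Lemma le_of_le_add_div (a b C : R) : 0 <= C ->
  (forall k, (0 < k)%N -> a <= b + k%:R^-1 * C) -> a <= b.
Proof.
move=> C0 h; apply/ler_addgt0Pr => e e0.
have [k] : exists k : nat, C / e <= k%:R.
  by exists (Num.bound (C / e)); rewrite ltW// archi_boundP// divr_ge0// ltW.
move=> Ck; apply: (le_trans (h k.+1 isT)); rewrite lerD2l ler_pdivrMl//.
rewrite ler_pdivrMr// in Ck; apply: (le_trans Ck).
by rewrite ler_wpM2r ?ltW// ltr_nat.
Qed.

(* Riesz's proof of the mean ergodic theorem: an average of nearly minimal
   square norm is close to all later ones, by the parallelogram identity. *)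
Lemma averages_square_close f (e : R) : IB f -> 0 < e ->
  exists2 n, (0 < n)%N & exists N, forall k, (N <= k)%N -> (0 < k)%N ->
    sq (fun x => average S n f x - average S k f x) <= e.
Proof.
move=> If e0; have [fi [M M0 fM]] := If; have Vf := IB_L1Loo If.
have Iav k g : IB g -> IB (average S k g).
  by exact: (DS_IB (DS_average k DSS)).
(* The index [0] is excluded: the zero average would make the infimum [0]. *)
pose A := [set sq (average S n f) | n in [set n | (0 < n)%N]].
have hA : has_inf A.
  by split; [exists (sq (average S 1 f)), 1%N|exists 0 => _ [n _ <-]; exact: sq_ge0].
have [_ [n /= n0 <-] nA] := @inf_adherent _ A (e / 8) ltac:(lra) hA.
have mA k : (0 < k)%N -> inf A <= sq (average S k f).
  by move=> k0; apply: ge_inf; [case: hA|exists k].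
exists n => //.
pose C j : R := j%:R * (2 * M).
have C0 j : 0 <= C j by rewrite mulr_ge0// mulr_ge0.
have L0 : 0 <= n1 f by exact: n1_ge0.
have n1av k g : IB g -> n1 (average S k g) <= n1 g.
  by case=> gi _; exact: (DS_n1 (DS_average k DSS)).
have [N CN] : exists N : nat, C n * (n1 f + n1 f) <= N%:R * (e / 4).
  exists (Num.bound (C n * (n1 f + n1 f) / (e / 4))).
  rewrite -ler_pdivrMr; last lra.
  rewrite ltW// archi_boundP// divr_ge0//; last lra.
  by rewrite mulr_ge0// addr_ge0.
exists N => k Nk k0.
have If_n := Iav n _ If; have If_k := Iav k _ If.
(* For large [k], [average S k f] is uniformly close to [average S k (average S n f)], whose square
   norm is at most that of [average S n f]. *)
have upper : sq (average S k f) <= sq (average S n f) + e / 4.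
  have h := sq_close If_k (Iav k _ If_n) (mulr_ge0 _ (C0 n)).
  have {}h := h k%:R^-1 ltac:(by []).
  have := average_average_close k Vf M0 fM n0.
  have E : ae_bounded mu (k%:R^-1 * C n) (fun x => average S k (average S n f) x
      - average S k f x) -> ae_bounded mu (k%:R^-1 * C n) (fun x =>
      average S k f x - average S k (average S n f) x).
    by apply: filterS => x; rewrite distrC.
  move=> /E/h /le_trans; apply; apply: lerD.
    exact: (DS_sq (DS_average k DSS)).
  apply: (@le_trans _ _ (k%:R^-1 * (C n * (n1 f + n1 f)))).
    rewrite -mulrA ler_wpM2l// ler_wpM2l// lerD// ?n1av//.
    by rewrite (le_trans (n1av _ _ If_n))// n1av.
  rewrite ler_pdivrMl ?ltr0n// (le_trans CN)// ler_wpM2r ?ler_nat//; lra.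
pose h x := average S n f x + average S k f x.
have Ih : IB h by exact: IBD.
(* The infimum is over averages only, and [h / 2] need not be one. But [average S j h] approaches
   [2 * average S j f] as [j] grows, and averaging does not increase [sq]. *)
have lower : 4 * inf A <= sq h.
  apply: (@le_of_le_add_div _ _ ((C n + C k) * (n1 f *+ 4))).
    by rewrite mulr_ge0 ?addr_ge0// mulrn_wge0.
  move=> j j0; have If_j := Iav j _ If.
  have close : ae_bounded mu (j%:R^-1 * (C n + C k))
      (fun x => 2 * average S j f x - average S j h x).
    apply: filterS2 (average_average_close j Vf M0 fM n0)
      (filterI (average_average_close j Vf M0 fM k0)
        (DSD (DS_average j DSS) (Vav n Vf) (Vav k Vf))) => x h1 [h2 ->].
    rewrite mulrDr.
    have -> : 2 * average S j f x -
        (average S j (average S n f) x + average S j (average S k f) x) =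
      - (average S j (average S n f) x - average S j f x) -
        (average S j (average S k f) x - average S j f x) by ring.
    by rewrite (le_trans (ler_normB _ _))// normrN lerD.
  have := sq_close (IBZ 2 If_j) (Iav j _ Ih)
    (mulr_ge0 _ (addr_ge0 (C0 n) (C0 k))) close.
  move=> /(_ ltac:(by [])); rewrite sq2// => hj.
  apply: (@le_trans _ _ (4 * sq (average S j f))); first by rewrite ler_wpM2l// mA.
  apply: (le_trans hj); apply: lerD; first exact: (DS_sq (DS_average j DSS)).
  rewrite -mulrA ler_wpM2l// ler_wpM2l ?addr_ge0//.
  rewrite n1Z; last by case: If_j.
  rewrite ger0_norm// -[4%N]/(2 + 2)%N mulrnDr lerD//.
    by rewrite -[n1 f *+ 2]mulr_natl ler_wpM2l// n1av.
  rewrite (le_trans (n1av j _ Ih))// (le_trans (n1D (proj1 If_n) (proj1 If_k)))//.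
  by rewrite mulr2n lerD// n1av.
(* The excesses over the infimum add up to [2 * (e / 8) + 2 * (e / 8 + e / 4) = e]. *)
have := parallelogram If_n If_k; rewrite -/h.
move: nA upper lower; lra.
Qed.

End averages.

(** * Almost uniform convergence from maximal estimates *)

Section almost_uniform_convergence.
Context {d : measure_display} {T : measurableType d} {R : realType}.
Variable mu : {measure set T -> \bar R}.
Implicit Types (u : nat -> T -> R) (v f : T -> R) (a e M : R).
Local Notation V := (L1_plus_Loo mu).
Local Notation IB := (integrable_bounded mu).

Definition tail_deviation u v n a : set T :=
  \bigcup_(k in [set k | (n <= k)%N]) [set x | a < `|u k x - v x|].

Lemma measurable_tail_deviation u v n a :
  (forall k, measurable_fun setT (u k)) -> measurable_fun setT v ->
  measurable (tail_deviation u v n a).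
Proof.
move=> mu_ mv; apply: bigcup_measurable => k _.
by apply: (@measurable_setgt _ _ _ a (fun x => u k x - v x)); exact: measurable_funB.
Qed.

Lemma excess_le_square a f : measurable_fun setT f -> 0 < a ->
  (excess mu a f <= a^-1%:E * square_norm mu f)%E.
Proof.
move=> mf a0; have ai : 0 <= a^-1 by rewrite invr_ge0 ltW.
rewrite -ge0_integralZl_EFin//; last 2 first.
- by move=> x _; rewrite lee_fin sqr_ge0.
- exact/measurable_EFinP/measurable_sqr.
under [leRHS]eq_integral do rewrite -EFinM.
apply: ge0_le_integral_ae.
- exact: measurable_excess.
- by apply: measurable_funM => //; exact: measurable_sqr.
- by move=> x; rewrite le_max lexx orbT.
- by move=> x; rewrite mulr_ge0// sqr_ge0.
apply: aeW => x; rewrite ge_max mulr_ge0 ?sqr_ge0// andbT.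
rewrite -[f x ^+ 2]real_normK ?num_real// ler_pdivlMl//.
by have := normr_ge0 (f x); nra.
Qed.

Lemma excess_cvg0 f e : integrable1 mu f -> 0 < e ->
  exists2 M, 0 <= M & (excess mu M f <= e%:E)%E.
Proof.
move=> fi e0; have [mf f1] := fi.
have fint : mu.-integrable setT (fun x => (`|f x|)%:E).
  by apply/integrable1P; split; [exact: measurableT_comp|
    rewrite /norm1; under eq_integral do rewrite normr_id].
have cvg0 : \forall x \ae mu, setT x ->
    (Num.max (`|f x| - n%:R) 0)%:E @[n --> \oo] --> (0 : \bar R)%E.
  apply: aeW => x _; apply: cvg_near_cst.
  near=> n; rewrite (max_idPr _)// subr_le0.
  by near: n; exact: nbhs_infty_ger.
have dom : \forall x \ae mu, forall n : nat, setT x ->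
    (`|(Num.max (`|f x| - n%:R) 0)%:E| <= (`|f x|)%:E)%E.
  apply: aeW => x n _ /=; rewrite lee_fin ger0_norm ?le_max ?lexx ?orbT//.
  by rewrite ge_max normr_ge0 gerBl ler0n.
have [_ _] := dominated_convergence measurableT
  (fun n => (measurable_EFinP _ _).2 (measurable_excess n%:R mf))
  (measurable_cst _) cvg0 fint dom.
rewrite integral0 => h.
suff : \forall n \near \oo, (excess mu n%:R f <= e%:E)%E.
  by case=> n _ /(_ n (leqnn n)) hn; exists n%:R.
have /fine_cvgP[fin /cvgrPdist_le/(_ e e0) hh] :
    (excess mu n%:R f) @[n --> \oo] --> 0%:E.
  exact: h.
near=> n.
have : `|0 - fine (excess mu n%:R f)| <= e by near: n.
rewrite sub0r normrN ger0_norm ?fine_ge0 ?excess_ge0// -lee_fin fineK//.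
by near: n.
Unshelve. all: by end_near. Qed.

Section ergodic_averages.
Variable S : (T -> R) -> (T -> R).
Hypothesis DSS : DS mu S.

Let Vav j f : V f -> V (average S j f).
Proof. exact: (DS_L1Loo (DS_average j DSS)). Qed.

Let mav j f : V f -> measurable_fun setT (average S j f).
Proof. by move=> Vf; exact/L1Loo_measurable/Vav. Qed.

(** The part of [f] below height [a] has averages below [a], so the part above must have one
    exceeding [a]. Its [L1] norm is [excess mu a f], at most [a^-1] times the square norm, and the
    maximal inequality gives the second factor [a^-1]. *)
Lemma weak_type_square f a : IB f -> 0 < a ->
  (mu (\bigcup_n [set x | (a *+ 2 < `|average S n f x|)%R]) <=
   (a ^- 2)%:E * square_norm mu f)%E.
Proof.
move=> If a0; have mf := IB_measurable If; have Vf := IB_L1Loo If.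
pose lo x := trunc a (f x); pose hi x := f x - lo x.
have mlo : measurable_fun setT lo by exact: (@measurable_trunc _ _ _ (cst a)).
have lo_bd : ae_bounded mu a lo by apply: aeW => x; apply/trunc_bound/ltW.
have Vlo := ae_bounded_L1Loo mlo lo_bd.
have mhi : measurable_fun setT hi by exact: measurable_funB.
have hi1 : integrable1 mu hi.
  apply: (le_integrable1 mhi (proj1 If)); apply: aeW => x.
  by rewrite -(trunc_split (f x) (ltW a0)) lerDl.
have Vhi := integrable1_L1Loo hi1.
have hiE : norm1 mu hi = excess mu a f.
  by apply: eq_integral => x _; rewrite trunc_rest// ltW.
have fE : f = fun x => lo x + hi x by apply/funext => x; rewrite /hi subrKC.
apply: (@le_trans _ _ (mu (\bigcup_n [set x | a < `|average S n hi x|]))).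
  apply: le_measure_ae.
  - by apply: bigcup_measurable => n _; apply: measurable_setgt; exact: mav.
  - by apply: bigcup_measurable => n _; apply: measurable_setgt; exact: mav.
  have /ae_foralln h1 : forall n, ae_bounded mu a (average S n lo).
    by move=> n; apply: (average_bounded DSS) => //; exact: ltW.
  have /ae_foralln h2 := fun n => DSD (DS_average n DSS) Vlo Vhi.
  apply: filterS2 h1 h2 => x h1 h2 [n _ /= an]; exists n => //=.
  move: an; rewrite fE h2 mulr2n => an.
  have := lt_le_trans an (ler_normD _ _); have := h1 n; lra.
have := maximal_inequality DSS hi1 a0; rewrite -lee_pdivlMl//.
move=> /le_trans; apply; rewrite hiE -exprVn expr2 EFinM -muleA.
apply: lee_wpmul2l; last exact: excess_le_square.
by rewrite lee_fin invr_ge0 ltW.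
Qed.

Lemma average1 f : average S 1 f = f.
Proof. by apply/funext => x; rewrite /average big_ord1 invr1 mul1r. Qed.

(* The tail of the averages of [f] is compared with [g := average S N f]:
   for [k] much larger than [n], [g' := average S k f] is almost invariant, so
   that [average S n g - g] is governed by [average S n (g - g')]. *)
Lemma bounded_averages_nearly_constant f a e : IB f -> 0 < a -> 0 < e ->
  exists2 v, measurable_fun setT v & exists n,
    (mu (tail_deviation (fun n => average S n f) v n a) <= e%:E)%E.
Proof.
move=> If a60 e0; have Vf := IB_L1Loo If; have [fi [M M0 fM]] := If.
(* Five shares of [b] go to [average S n g - g], one to replacing [average S n g] by
   [average S n f]. The tolerance [e * b ^+ 2] below is what [weak_type_square] at level [b] turns
   into measure [e]. *)
pose b := a / 6; have b0 : 0 < b by rewrite /b; lra.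
have IBav k g : IB g -> IB (average S k g) by exact: (DS_IB (DS_average k DSS)).
have [N N0 [K hK]] := averages_square_close DSS If (mulr_gt0 e0 (exprn_gt0 2 b0)).
pose g := average S N f; have Ig : IB g := IBav N f If; have Vg := IB_L1Loo Ig.
have mg := L1Loo_measurable Vg.
exists g => //.
(* The auxiliary [k] must be large compared with [n], so finitely many indices are treated at a
   time; the bound is independent of [m] and passes to the increasing union. *)
have finite_step m : (mu (\bigcup_(n in [set n | (0 < n <= m)%N])
    [set x | (b *+ 5 < `|average S n g x - g x|)%R]) <= e%:E)%E.
  pose k := maxn (maxn K 1) (Num.bound (m%:R * (2 * M) / b)).
  have Kk : (K <= k)%N by rewrite !leq_max leqnn.
  have k0 : (0 < k)%N by rewrite !leq_max orbT.
  have mk : m%:R * (k%:R^-1 * (2 * M)) <= b.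
    rewrite mulrCA ler_pdivrMl ?ltr0n// -ler_pdivrMr//.
    rewrite (le_trans (y := (Num.bound (m%:R * (2 * M) / b))%:R))//.
      rewrite ltW// archi_boundP// divr_ge0//; last exact: ltW.
      by rewrite mulr_ge0// mulr_ge0.
    by rewrite ler_nat leq_max leqnn orbT.
  pose g' := average S k f; have Ig' : IB g' := IBav k f If.
  have Vg' := IB_L1Loo Ig'; have mg' := L1Loo_measurable Vg'.
  pose w x := g x - g' x; have Iw : IB w by exact: IBB.
  have Vw := IB_L1Loo Iw.
  have sqw := hK k Kk k0.
  apply: (@le_trans _ _ (mu (\bigcup_n [set x | b *+ 2 < `|average S n w x|]))).
    apply: le_measure_ae.
    - apply: bigcup_measurable => n _.
      apply: (@measurable_setgt _ _ _ (b *+ 5) (fun x => average S n g x - g x)).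
      by apply: measurable_funB => //; exact: mav.
    - by apply: bigcup_measurable => n _; apply: measurable_setgt; exact: mav.
    have c0 : 0 <= k%:R^-1 * (2 * M) by rewrite mulr_ge0// mulr_ge0.
    have /ae_foralln h1 : forall n, \forall x \ae mu,
        (0 < n)%N -> `|average S n g' x - g' x| <= n%:R * (k%:R^-1 * (2 * M)).
      move=> n; have [n0|] := ltnP 0 n; last by move=> _; exact: aeW.
      have := average_almost_invariant DSS k Vf M0 fM.
      move=> /(almost_invariant_average DSS Vg' c0 n0).
      by apply: filterS => x.
    have /ae_foralln h2 := fun n => DSB (DS_average n DSS) Vg Vg'.
    apply: filterS2 h1 h2 => x h1 h2 [n /= /andP[n0 nm]] hn.
    have {}h1 := h1 n n0.
    have {}h1 : `|average S n g' x - g' x| <= b.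
      apply: (le_trans h1); apply: le_trans mk.
      by rewrite ler_wpM2r// ler_nat.
    (* A large [w x] is itself an average, with index [1]. Otherwise [5 b] minus [b] for [g'] and
       [2 b] for [w] leaves more than [2 b] for [average S n w]. *)
    have [wx|wx] := ltP (b *+ 2) `|w x|.
      by exists 1%N => //=; rewrite average1.
    exists n => //=; rewrite h2.
    move: hn; rewrite (_ : _ - g x = (average S n g x - average S n g' x) +
      ((average S n g' x - g' x) - w x)); last by rewrite /w; ring.
    move=> /lt_le_trans/(_ (ler_normD _ _)).
    have := ler_normB (average S n g' x - g' x) (w x).
    by move: h1 wx; rewrite !mulr2n mulrS; lra.
  rewrite (le_trans (weak_type_square Iw b0))// square_normE// -EFinM lee_fin.
  by rewrite ler_pdivrMl ?exprn_gt0// mulrC.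
pose C := N%:R * (2 * M).
have C0 : 0 <= C by rewrite mulr_ge0// mulr_ge0.
(* From this index on, averaging [g] instead of [f] costs at most [C / n <= b]. *)
exists (maxn 1 (Num.bound (C / b))).
apply: (@le_trans _ _ (mu (\bigcup_m \bigcup_(n in [set n | (0 < n <= m)%N])
    [set x | b *+ 5 < `|average S n g x - g x|]))); last first.
  apply: measure_bigcup_le => //.
  - move=> m; apply: bigcup_measurable => n _.
    apply: (@measurable_setgt _ _ _ (b *+ 5) (fun x => average S n g x - g x)).
    by apply: measurable_funB => //; exact: mav.
  - move=> m p mp; apply/subsetPset; apply: bigcup_subset => n /= /andP[-> nm].
    exact: leq_trans mp.
apply: le_measure_ae.
- by apply: measurable_tail_deviation => // k; exact: mav.
- apply: bigcup_measurable => m _; apply: bigcup_measurable => n _.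
  apply: (@measurable_setgt _ _ _ (b *+ 5) (fun x => average S n g x - g x)).
  by apply: measurable_funB => //; exact: mav.
have /ae_foralln := fun k => average_average_close DSS k Vf M0 fM N0.
apply: filterS => x h [n /= nC hn].
have n0 : (0 < n)%N by rewrite (leq_trans _ nC)// leq_max.
exists n => //; exists n => //=; first by rewrite n0 leqnn.
have {}h := h n.
have {}h : `|average S n g x - average S n f x| <= b.
  apply: (le_trans h); rewrite ler_pdivrMl ?ltr0n// -ler_pdivrMr//.
  apply: (@le_trans _ _ (Num.bound (C / b))%:R).
    by rewrite ltW// archi_boundP// divr_ge0// ltW.
  by rewrite ler_nat (leq_trans _ nC)// leq_max leqnn orbT.
have := ler_normB (average S n g x - g x) (average S n g x - average S n f x).
rewrite (_ : _ - (_ - _) = average S n f x - g x); last by ring.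
by move: hn h; rewrite mulrS /b; lra.
Qed.

(** Write [f = lo + m + r] and grant each piece a third of [a]: [lo] is below [b] and so are its
    averages, [m] is integrable and bounded, and [M] is so large that the maximal inequality at
    level [b] allots measure [e / 2] to [r]. *)
Lemma averages_nearly_constant f a e : V f ->
  (forall t, 0 < t -> (excess mu t f < +oo)%E) -> 0 < a -> 0 < e ->
  exists2 v, measurable_fun setT v & exists n,
    (mu (tail_deviation (fun n => average S n f) v n a) <= e%:E)%E.
Proof.
move=> Vf fex a0 e0; have mf := L1Loo_measurable Vf.
pose b := a / 3; have b0 : 0 < b by rewrite /b; lra.
pose lo x := trunc b (f x); pose hi x := f x - lo x.
have mlo : measurable_fun setT lo by exact: (@measurable_trunc _ _ _ (cst b)).
have lo_bd : ae_bounded mu b lo by apply: aeW => x; apply/trunc_bound/ltW.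
have Vlo := ae_bounded_L1Loo mlo lo_bd.
have mhi : measurable_fun setT hi by exact: measurable_funB.
have hi1 : integrable1 mu hi.
  split => //; have := fex b b0; congr (_ < _)%E.
  by apply: eq_integral => x _; rewrite trunc_rest// ltW.
have [M M0 hM] := excess_cvg0 hi1 (mulr_gt0 (divr_gt0 e0 (ltr0n R 2)) b0).
pose m x := trunc M (hi x); pose r x := hi x - m x.
have mm : measurable_fun setT m by exact: (@measurable_trunc _ _ _ (cst M)).
have mr : measurable_fun setT r by exact: measurable_funB.
have Im : IB m.
  split; last by exists M => //; apply: aeW => x; exact: trunc_bound.
  by apply: (le_integrable1 mm hi1); apply: aeW => x; exact: trunc_le.
have r1 : integrable1 mu r.
  apply: (le_integrable1 mr hi1); apply: aeW => x.
  by rewrite -(trunc_split (hi x) M0) lerDl.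
have rE : norm1 mu r = excess mu M hi.
  by apply: eq_integral => x _; rewrite trunc_rest.
have Vm := IB_L1Loo Im; have Vr := integrable1_L1Loo r1.
have [v mv [n hn]] := bounded_averages_nearly_constant Im b0
  (divr_gt0 e0 (ltr0n R 2)).
exists v => //; exists n.
have mdev : measurable (tail_deviation (fun n => average S n m) v n b).
  by apply: measurable_tail_deviation => // k; exact: mav.
have mbig : measurable (\bigcup_n [set x | b < `|average S n r x|]).
  by apply: bigcup_measurable => k _; apply: measurable_setgt; exact: mav.
apply: (@le_trans _ _ (mu (tail_deviation (fun n => average S n m) v n b `|`
   \bigcup_n [set x | b < `|average S n r x|]))).
  apply: le_measure_ae.
  - by apply: measurable_tail_deviation => // k; exact: mav.
  - exact: measurableU.
  have /ae_foralln h1 : forall n, ae_bounded mu b (average S n lo).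
    by move=> k; apply: (average_bounded DSS) => //; exact: ltW.
  have /ae_foralln h2 := fun n => DSD (DS_average n DSS) Vlo (L1LooD Vm Vr).
  have /ae_foralln h3 := fun n => DSD (DS_average n DSS) Vm Vr.
  apply: filterS2 h1 (filterI h2 h3) => x {}h1 [{}h2 {}h3] [k /= nk hk].
  have [rk|rk] := ltP b `|average S k r x|; [right|left]; exists k => //=.
  move: hk; have fE : f = fun x => lo x + (m x + r x).
    by apply/funext => y; rewrite /r [m y + _]subrKC /hi subrKC.
  rewrite {1}fE h2 h3.
  rewrite (_ : _ - v x = average S k lo x + (average S k r x +
     (average S k m x - v x))); last by ring.
  move=> /lt_le_trans/(_ (ler_normD _ _)).
  have := ler_normD (average S k r x) (average S k m x - v x).
  by move: rk (h1 k); rewrite /b; lra.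
rewrite (le_trans (measureU2 _ mdev mbig))// [e in leRHS]splitr EFinD leeD//.
have := maximal_inequality DSS r1 b0; rewrite rE -lee_pdivlMl//.
move=> /le_trans; apply; rewrite lee_pdivrMl// (le_trans hM)// -EFinM lee_fin.
by rewrite mulrC.
Qed.

End ergodic_averages.

(** The comparison function may change with the tolerance. Discarding, for each [j], a set of
    measure [e / 2^(j+1)] off which the tail stays within [1/(j+1)] of the [j]-th one leaves a set
    on which the sequence is uniformly Cauchy. *)
Lemma au_cvg_of_nearly_constant u :
  (forall n, measurable_fun setT (u n)) ->
  (forall a e, 0 < a -> 0 < e -> exists2 v, measurable_fun setT v &
    exists n, (mu (tail_deviation u v n a) <= e%:E)%E) ->
  exists v, [/\ measurable_fun setT v, au_cvg mu u v &
    \forall x \ae mu, u n x @[n --> \oo] --> v x].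
Proof.
move=> mu_ hu.
(* One limit for all exceptional sets: the upper limit is measurable whether or not the sequence
   converges, and [fine] supplies a value where it is infinite. *)
pose v x := fine (limn_esup (fun n => (u n x)%:E)).
have mv : measurable_fun setT v.
  apply: measurableT_comp; first exact: fine_measurable.
  by apply: measurable_fun_limn_esup => n; exact/measurable_EFinP.
have [good Hgood] : exists G : R -> set T, forall e, 0 < e ->
    [/\ measurable (G e), (mu (~` G e) <= e%:E)%E &
     forall a, 0 < a -> exists n, forall k x, (n <= k)%N -> G e x ->
       u n x @[n --> \oo] --> v x /\ `|v x - u k x| <= a].
  suff H : forall e, exists G, 0 < e ->
    [/\ measurable G, (mu (~` G) <= e%:E)%E &
     forall a, 0 < a -> exists n, forall k x, (n <= k)%N -> G x ->
       u n x @[n --> \oo] --> v x /\ `|v x - u k x| <= a].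
    by exists (fun e => projT1 (cid (H e))) => e e0; case: cid => //= G; exact.
  move=> e; have [e0|] := ltP 0 e; last by exists set0.
  have he j : 0 < e / (2 ^ j.+1)%:R :> R by rewrite divr_gt0// ltr0n expn_gt0.
  have ha j : 0 < j.+1%:R^-1 :> R by rewrite invr_gt0.
  have H j : exists p : (T -> R) * nat, measurable_fun setT p.1 /\
      (mu (tail_deviation u p.1 p.2 j.+1%:R^-1) <= (e / (2 ^ j.+1)%:R)%:E)%E.
    by have [w mw [n hn]] := hu _ _ (ha j) (he j); exists (w, n).
  pose p j := projT1 (cid (H j)).
  have mp j : measurable_fun setT (p j).1 by rewrite /p; case: cid => /= q [].
  have hp j : (mu (tail_deviation u (p j).1 (p j).2 j.+1%:R^-1) <=
      (e / (2 ^ j.+1)%:R)%:E)%E by rewrite /p; case: cid => /= q [].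
  pose F j := tail_deviation u (p j).1 (p j).2 j.+1%:R^-1.
  have mF j : measurable (F j) by exact: measurable_tail_deviation.
  exists (~` \bigcup_j F j) => _; split.
  - by apply: measurableC; exact: bigcup_measurable.
  - rewrite setCK (le_trans (measure_sigma_subadditive mu mF _ (subset_refl _)))//.
      exact: bigcup_measurable.
    apply: (@le_trans _ _ (\sum_(0 <= j <oo) (e / (2 ^ j.+1)%:R)%:E)%E).
      by apply: lee_nneseries => // j _; exact: hp.
    by apply: epsilon_trick0; exact: ltW.
  have near_v j k x : (~` \bigcup_j F j) x -> ((p j).2 <= k)%N ->
      `|u k x - (p j).1 x| <= j.+1%:R^-1.
    move=> nF pk; rewrite leNgt; apply/negP => h; apply: nF.
    by exists j => //; exists k.
  have archi a : 0 < a -> exists j : nat, j.+1%:R^-1 *+ 2 <= a.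
    move=> a0; exists (Num.bound (2 / a)); rewrite -[_ *+ 2]mulr_natl ler_pdivrMr//.
    rewrite mulrC -ler_pdivrMr// (@le_trans _ _ (Num.bound (2 / a))%:R)//.
      by rewrite ltW// archi_boundP// divr_ge0// ltW.
    by rewrite ler_nat.
  have cvg_v x : (~` \bigcup_j F j) x -> u n x @[n --> \oo] --> v x.
    move=> Gx; have cu : cvgn (u ^~ x).
      apply: cauchy_cvg; apply: cauchy_exP => eps eps0.
      have [j hj] := archi eps eps0; exists ((p j).1 x).
      exists (p j).2 => //= k pk; rewrite /ball/= distrC.
      rewrite (le_lt_trans (near_v j k x Gx pk))//.
      by rewrite (lt_le_trans _ hj)// mulr2n ltrDl.
    have /cvg_ex[l ul] := cu.
    suff -> : v x = l by [].
    have eul : (u n x)%:E @[n --> \oo] --> l%:E.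
      by apply: cvg_EFin => //; exact: nearW.
    by rewrite /v (cvg_limn_einf_sup eul).2.
  move=> a a0; have [j ja] := archi a a0; exists (p j).2 => k x pk Gx.
  split; first exact: cvg_v.
  (* Go from [v x] to a far term [u n x] at cost [eta], then through the [j]-th comparison function
     to [u k x] at cost [2/(j+1) <= a]. *)
  apply/ler_addgt0Pr => eta eta0.
  have /cvgrPdist_le/(_ eta eta0)[n _ hn] := cvg_v x Gx.
  have := hn (maxn n (p j).2) (leq_maxl _ _) => /= hv.
  have h1 := near_v j (maxn n (p j).2) x Gx (leq_maxr _ _).
  have h2 := near_v j k x Gx pk.
  set w := (p j).1 x in h1 h2; set y := u (maxn n (p j).2) x in hv h1.
  have := ler_distD y (v x) (u k x); have := ler_distD w y (u k x).
  rewrite (distrC w); move: (_^-1) ja h1 h2 => c ja h1 h2 t1 t2.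
  rewrite mulr2n in ja; apply: (le_trans t2); rewrite addrC; apply: lerD => //.
  by apply: (le_trans t1); apply: le_trans ja; apply: lerD.
exists v; split => //.
- move=> e e0; have [mG Ge hG] := Hgood e e0; exists (good e); split => //.
  set N := (fun n => _).
  suff H : forall a, 0 < a -> \forall n \near \oo, (N n <= a%:E)%E.
    have N0 n : (0 <= N n)%E by exact: Lnorm_ge0.
    apply/fine_cvgP; split.
      apply: filterS (H 1 ltr01) => n h.
      by rewrite ge0_fin_numE// (le_lt_trans h)// ltry.
    apply/cvgrPdist_le => a a0; apply: filterS (H a a0) => n h /=.
    rewrite sub0r normrN ger0_norm ?fine_ge0// -lee_fin fineK//.
    by rewrite ge0_fin_numE// (le_lt_trans h)// ltry.
  move=> a a0; have [n hn] := hG a a0; exists n => // k /= nk.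
  apply/Lnormy_le; first exact: ltW.
  apply: aeW => x; rewrite normrM indicE; case: (boolP (x \in good e)) => Gx.
    by rewrite normr1 mulr1; have [] := hn k x nk (set_mem Gx).
  by rewrite normr0 mulr0 ltW.
- have k0 k : 0 < k.+1%:R^-1 :> R by rewrite invr_gt0.
  exists (\bigcap_k ~` good k.+1%:R^-1); split.
  + apply: bigcapT_measurable => k; apply: measurableC.
    by case: (Hgood _ (k0 k)).
  + apply/eqP; rewrite -measure_le0; apply/lee_addgt0Pr => e e0.
    pose k := Num.bound e^-1; rewrite add0e.
    have [mG Ge _] := Hgood _ (k0 k).
    apply: (@le_trans _ _ (mu (~` good k.+1%:R^-1))).
      apply: le_measure; rewrite ?inE.
      * apply: bigcapT_measurable => j; apply: measurableC.
        by case: (Hgood _ (k0 j)).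
      * exact: measurableC.
      * by move=> x /(_ k I).
    rewrite (le_trans Ge)// lee_fin invf_ple ?posrE//.
    rewrite (@le_trans _ _ (Num.bound e^-1)%:R)//.
      by rewrite ltW// archi_boundP// invr_ge0 ltW.
    by rewrite ler_nat.
  + move=> x /= nx k _ Gx; apply: nx.
    have [_ _ hG] := Hgood _ (k0 k).
    by have [n /(_ n x (leqnn n) Gx)[]] := hG 1 ltr01.
Unshelve. all: by end_near. Qed.

End almost_uniform_convergence.

(** * Rearrangements and fully symmetric spaces *)

Section layer_cake.
Context {d : measure_display} {T : measurableType d} {R : realType}.

(** Tonelli's theorem for the indicator of the region under the graph. *)
Lemma ge0_layer_cake_sfinite (mu : {sigma_finite_measure set T -> \bar R})
    (f : T -> R) :
  measurable_fun setT f -> (forall x, 0 <= f x) ->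
  (\int[mu]_x (f x)%:E =
   \int[lebesgue_measure]_(r in `]0%R, +oo[) mu [set x | (r < f x)%R])%E.
Proof.
move=> mf f0; pose GR := measurableTypeR R.
pose A : set (T * GR) := [set p | 0 < p.2] `&` [set p | p.2 < f p.1].
have mA : measurable A.
  apply: measurableI; apply: measurable_setltr => //.
  exact: measurableT_comp.
transitivity (\int[mu]_x \int[lebesgue_measure]_r (\1_A (x, r))%:E)%E.
  apply: eq_integral => x _.
  rewrite (_ : (fun r : GR => (\1_A (x, r))%:E) = (fun r => (\1_`]0, f x[ r)%:E)).
    rewrite integral_indic//= setIT lebesgue_measure_itv/= lte_fin sube0.
    by case: ltP => // fx0; congr EFin; apply/eqP; rewrite eq_le f0 fx0.
  apply/funext => r; congr (_%:R%:E); congr nat_of_bool.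
  apply/idP/idP; rewrite !inE /A/= in_itv/=; first by move=> [-> ->].
  by move=> /andP[].
rewrite (fubini_tonelli (fun p : T * GR => (\1_A p)%:E)); last 2 first.
- exact/measurable_EFinP/measurable_indic.
- by move=> p; rewrite lee_fin.
rewrite [RHS]integral_mkcond; apply: eq_integral => r _.
rewrite patchE mem_setE in_itv/= andbT; case: ifPn => r0.
  rewrite (_ : (fun x => (\1_A (x, r))%:E) = (fun x => (\1_[set x | r < f x] x)%:E)).
    rewrite integral_indic ?setIT//; exact: measurable_setltr.
  apply/funext => x; congr (_%:R%:E); congr nat_of_bool.
  by apply/idP/idP; rewrite !inE /A/=; [case|].
rewrite integral0_eq// => x _; rewrite indicE memNset//= => -[]/=.
by move: r0; rewrite -leNgt leNgt => /negbTE ->.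
Qed.

(** Tonelli expects sigma-finiteness bundled with the measure, so the hypothesis is packed into a
    structure on the same set function. *)
Lemma ge0_layer_cake (mu : {measure set T -> \bar R}) (f : T -> R) :
  sigma_finite setT mu -> measurable_fun setT f -> (forall x, 0 <= f x) ->
  (\int[mu]_x (f x)%:E =
   \int[lebesgue_measure]_(r in `]0%R, +oo[) mu [set x | (r < f x)%R])%E.
Proof.
case: mu => m cm sf; pose M := Measure.Pack cm.
pose sfm := Measure_isSigmaFinite.Build _ _ _ M sf.
pose mu' : {sigma_finite_measure set T -> \bar R} := HB.pack m cm sfm.
exact: (ge0_layer_cake_sfinite mu').
Qed.

End layer_cake.

(** * Distribution functions and decreasing rearrangements *)

Section rearrangement_theory.
Context {d : measure_display} {T : measurableType d} {R : realType}.
Variable mu : {measure set T -> \bar R}.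
Implicit Types (f h : T -> R) (a s t : R).
Local Notation dist f := (distribution_fun mu setT f).
Local Notation star f := (rearrangement mu setT f).
Local Notation L0 := (L0_mu mu setT).

Lemma distE f a : dist f a = mu [set x | a < `|f x|].
Proof. by rewrite /distribution_fun setTI. Qed.

Lemma measurable_dist f a : L0 f -> measurable [set x | a < `|f x|].
Proof. by move=> [mf _]; exact: measurable_setgt. Qed.

Lemma le_dist f (a b : R) : L0 f -> a <= b -> (dist f b <= dist f a)%E.
Proof.
move=> Lf ab; rewrite !distE le_measure ?inE//; try exact: measurable_dist.
by move=> x /=; apply: le_lt_trans.
Qed.

(** Continuity from above along level sets that shrink to the empty set because [f] is finite; it
    applies since one of them has finite measure. *)
Lemma dist_small f t : L0 f -> 0 < t -> exists2 a, 0 < a & (dist f a <= t%:E)%E.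
Proof.
move=> Lf t0; have [mf [a a0 fa]] := Lf.
pose F n := [set x | a + n%:R < `|f x|].
have mF n : measurable (F n) by exact: measurable_dist.
have F0 : \bigcap_n F n = set0.
  rewrite -subset0 => x Fx; have := Fx (Num.bound `|f x|) I.
  rewrite /F/= ltNge => /negP; apply.
  by rewrite -[leLHS]add0r lerD// ltW// archi_boundP.
have := @nonincreasing_cvg_mu _ _ _ mu F.
rewrite F0 measure0 => cvgF.
have {}cvgF : mu (F n) @[n --> \oo] --> 0%E.
  apply: cvgF => //.
    by rewrite /F addr0 -distE.
  move=> m n mn; apply/subsetPset => x /=; apply: le_lt_trans.
  by rewrite lerD2l ler_nat.
have /fine_cvgP[fin /cvgrPdist_le/(_ t t0) near_t] := cvgF.
have [n _ /(_ n (leqnn n)) [nfin nt]] := filterI fin near_t.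
exists (a + n%:R); first by rewrite ltr_wpDr.
rewrite distE -[mu _]fineK// lee_fin; move: nt => /=.
by rewrite sub0r normrN => /(le_trans (ler_norm _)).
Qed.

Lemma dist_right_cont f a t : L0 f -> (t%:E < dist f a)%E ->
  exists2 b, a < b & (t%:E < dist f b)%E.
Proof.
move=> Lf ta; apply: contrapT => H.
suff : (dist f a <= t%:E)%E by rewrite leNgt ta.
rewrite distE (_ : [set x | _] = \bigcup_n [set x | a + n.+1%:R^-1 < `|f x|]).
  apply: measure_bigcup_le.
  - by move=> n; exact: measurable_dist.
  - move=> m n mn; apply/subsetPset => x /=; apply: le_lt_trans.
    by rewrite lerD2l lef_pV2 ?posrE// ler_nat.
  - move=> n; rewrite leNgt; apply/negP => h; apply: H.
    by exists (a + n.+1%:R^-1); [rewrite ltrDl|rewrite distE].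
apply/seteqP; split=> x /=.
  move=> ax; have e0 : 0 < `|f x| - a by rewrite subr_gt0.
  exists (Num.bound (`|f x| - a)^-1) => //=; rewrite -ltrBrDl.
  rewrite invf_plt ?posrE// (lt_le_trans (archi_boundP _))//.
    by rewrite invr_ge0 ltW.
  by rewrite ler_nat.
by move=> [n _ /=]; apply: lt_trans; rewrite ltrDl.
Qed.

Lemma star_ge0 f t : 0 <= star f t.
Proof.
rewrite /rearrangement; set A := [set _ | _].
have [->|/set0P A0] := eqVneq A set0; first by rewrite inf0.
by apply: lb_le_inf => // a [/ltW].
Qed.

(** Right continuity of [dist f] is what makes the two strict inequalities equivalent. Level sets of
    [star f] become initial intervals of length [dist f a]. *)
Lemma lt_star f a t : L0 f -> 0 < t -> 0 <= a ->
  (a < star f t) = (t%:E < dist f a)%E.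
Proof.
move=> Lf t0 a0; rewrite /rearrangement; set A := [set _ | _].
have A0 : A !=set0 by have [b b0 fb] := dist_small Lf t0; exists b.
have lbA : has_lbound A by exists 0 => b [/ltW].
apply/idP/idP.
  apply: contraTT; rewrite -!leNgt => fa; apply/ler_addgt0Pr => e e0.
  apply: ge_inf => //; split; first by rewrite ltr_wpDl.
  by rewrite (le_trans (le_dist Lf _) fa)// lerDl ltW.
move=> /(dist_right_cont Lf)[b ab tb]; rewrite (lt_le_trans ab)//.
apply: lb_le_inf => // c [c0 fc]; rewrite leNgt; apply/negP => cb.
by move: (lt_le_trans tb (le_dist Lf (ltW cb))); rewrite ltNge fc.
Qed.

Lemma star_noninc f s t : L0 f -> 0 < s -> s <= t -> star f t <= star f s.
Proof.
move=> Lf s0 st; rewrite leNgt; apply/negP.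
rewrite (lt_star Lf) ?star_ge0//; last exact: lt_le_trans st.
move=> h; have : (s%:E < dist f (star f s))%E by rewrite (le_lt_trans _ h)// lee_fin.
by rewrite -(lt_star Lf) ?star_ge0// ltxx.
Qed.

Lemma lebesgue_initial (y : \bar R) : (0 <= y)%E ->
  lebesgue_measure [set t : R | 0 < t /\ (t%:E < y)%E] = y.
Proof.
case: y => [y| |]// y0.
  rewrite (_ : [set _ | _] = `]0, y[%classic).
    rewrite lebesgue_measure_itv/= lte_fin sube0.
    case: ltP => // h; congr EFin; apply/eqP.
    by rewrite eq_le h andbT -lee_fin.
  by apply/seteqP; split=> t /=; rewrite in_itv/= ?lte_fin => /andP.
rewrite (_ : [set _ | _] = `]0, +oo[%classic).
  by rewrite lebesgue_measure_itv/= lt0y.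
by apply/seteqP; split=> t /=; rewrite in_itv/= andbT ?ltry// => -[].
Qed.

Lemma measurable_initial (y : \bar R) :
  measurable ([set t : R | 0 < t /\ (t%:E < y)%E] : set (measurableTypeR R)).
Proof.
apply: is_interval_measurable => s t /= [s0 sy] [t0 ty] r /andP[sr rt].
by split; [exact: lt_le_trans sr|rewrite (le_lt_trans _ ty)// lee_fin].
Qed.

(** Extension by zero, so that measurability and the layer cake formula can be used on the whole
    line. *)
Definition star0 f (t : R) := if 0 < t then star f t else 0.

Lemma star0_ge0 f t : 0 <= star0 f t.
Proof. by rewrite /star0; case: ifP => // _; exact: star_ge0. Qed.

Lemma star0_gt f a : L0 f -> 0 <= a ->
  [set t | a < star0 f t] = [set t | 0 < t /\ (t%:E < dist f a)%E].
Proof.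
move=> Lf a0; apply/seteqP; split=> t /=; rewrite /star0; case: ifPn => t0.
- by rewrite lt_star.
- by rewrite ltNge a0.
- by move=> [_]; rewrite lt_star.
- by case.
Qed.

Lemma measurable_star0 f : L0 f ->
  measurable_fun (setT : set (measurableTypeR R)) (star0 f).
Proof.
move=> Lf; apply: (measurability _ (RGenOInfty.measurableE R)) => //.
move=> _ [_ [a ->] <-]; rewrite setTI preimage_itvoy.
have [a0|a0] := leP 0 a; first by rewrite star0_gt//; exact: measurable_initial.
rewrite (_ : [set _ | _] = setT)//.
by apply/seteqP; split => // t _ /=; rewrite (lt_le_trans a0)// star0_ge0.
Qed.

Hypothesis mu_sigma_finite : sigma_finite setT mu.

(** Equimeasurability: by the layer cake formula both sides are the integral of [dist f (r + t)]
    over [r > 0]. *)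
Lemma integral_star_excess f t : L0 f -> 0 <= t ->
  (\int[lebesgue_measure]_(x in `]0%R, +oo[) (Num.max (star f x - t) 0)%:E =
   excess mu t f)%E.
Proof.
move=> Lf t0; have [mf _] := Lf.
pose F x := Num.max (star0 f x - t) 0.
have mF : measurable_fun (setT : set (measurableTypeR R)) F.
  by apply: measurable_maxr => //; apply: measurable_funB => //;
    exact: measurable_star0.
have F0 x : 0 <= F x by rewrite le_max lexx orbT.
have lebesgue_sf : sigma_finite setT (@lebesgue_measure R).
  exact: sigma_finiteT.
transitivity (\int[lebesgue_measure]_x (F x)%:E)%E.
  rewrite integral_mkcond; apply: eq_integral => x _; rewrite patchE /F /star0.
  rewrite mem_setE in_itv/= andbT; case: ifPn => // x0.
  by rewrite sub0r (max_idPr _)// oppr_le0.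
rewrite (ge0_layer_cake lebesgue_sf mF F0).
rewrite /excess (ge0_layer_cake mu_sigma_finite (measurable_excess t mf)); last first.
  by move=> x; rewrite le_max lexx orbT.
apply: eq_integral => r; rewrite inE/= in_itv/= andbT => r0.
have gtE (x : R) : (r < Num.max (x - t) 0) = (r + t < x).
  by rewrite lt_max [r < 0]ltNge (ltW r0) orbF ltrBrDr.
rewrite [X in lebesgue_measure X](_ : _ = [set x | r + t < star0 f x]); last first.
  by apply/seteqP; split=> x /=; rewrite /F gtE.
rewrite star0_gt//; last by rewrite addr_ge0// ltW.
rewrite lebesgue_initial; last by rewrite distE.
by rewrite distE; congr (mu _); apply/seteqP; split=> x /=; rewrite gtE.
Qed.

Lemma integral_initial_cst s t : 0 < s ->
  (\int[lebesgue_measure]_(x in `]0%R, s[) t%:E = (t * s)%:E)%E.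
Proof.
move=> s0; rewrite integral_cst//= lebesgue_measure_itv/= lte_fin s0.
by rewrite sube0 EFinM.
Qed.

Let mstar (D : set (measurableTypeR R)) f : L0 f -> measurable D ->
  D `<=` `]0, +oo[ -> measurable_fun D (EFin \o star f).
Proof.
move=> Lf mD D0; apply/measurable_EFinP.
apply: (eq_measurable_fun (star0 f)).
  by move=> x /set_mem/D0/=; rewrite in_itv/= andbT /star0 => ->.
by apply: measurable_funTS; exact: measurable_star0.
Qed.

Let mstarB (D : set (measurableTypeR R)) f t : L0 f -> measurable D ->
  D `<=` `]0, +oo[ ->
  measurable_fun D (fun x => (Num.max (star f x - t) 0)%:E).
Proof.
move=> Lf mD D0; apply/measurable_EFinP; apply: measurable_maxr => //.
by apply: measurable_funB => //; apply/measurable_EFinP; exact: mstar.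
Qed.

Let sub_initial s : `]0, s[%classic `<=` `]0 : R, +oo[%classic.
Proof. by move=> x /=; rewrite !in_itv/= => /andP[->]. Qed.

Let integral_initial_split s t f : L0 f -> 0 < s -> 0 <= t ->
  (\int[lebesgue_measure]_(x in `]0%R, s[) (t + Num.max (star f x - t) 0)%:E =
  (t * s)%:E +
    \int[lebesgue_measure]_(x in `]0%R, s[) (Num.max (star f x - t) 0)%:E)%E.
Proof.
move=> Lf s0 t0; rewrite -(integral_initial_cst t s0) -ge0_integralD//.
- by move=> x _; rewrite lee_fin le_max lexx orbT.
- exact: mstarB.
Qed.

Lemma integral_star_le f s t : L0 f -> 0 < s -> 0 <= t ->
  (\int[lebesgue_measure]_(x in `]0%R, s[) (star f x)%:E <=
   (t * s)%:E + excess mu t f)%E.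
Proof.
move=> Lf s0 t0.
have e0 (x : R) : 0 <= Num.max (star f x - t) 0 by rewrite le_max lexx orbT.
apply: (@le_trans _ _ (\int[lebesgue_measure]_(x in `]0%R, s[)
    (t + Num.max (star f x - t) 0)%:E)%E).
  apply: ge0_le_integral => //.
  - by move=> x _; rewrite lee_fin star_ge0.
  - exact: mstar.
  - apply/measurable_EFinP; apply: measurable_funD => //.
    by apply/measurable_EFinP; exact: mstarB.
  - by move=> x _; rewrite lee_fin -lerBlDl le_max lexx.
rewrite integral_initial_split// leeD2l// -integral_star_excess//.
apply: ge0_subset_integral => //; first exact: mstarB.
by move=> x _; rewrite lee_fin.
Qed.

(** The bound of [integral_star_le] is attained at [t = star f s], since monotonicity puts [star f]
    above [t] before [s] and below it afterwards. *)
Lemma integral_star_ge f s : L0 f -> 0 < s ->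
  ((star f s * s)%:E + excess mu (star f s) f <=
   \int[lebesgue_measure]_(x in `]0%R, s[) (star f x)%:E)%E.
Proof.
move=> Lf s0; have t0 := star_ge0 f s; set t := star f s.
have -> : excess mu t f =
    (\int[lebesgue_measure]_(x in `]0%R, s[) (Num.max (star f x - t) 0)%:E)%E.
  rewrite -integral_star_excess// integral_mkcond [RHS]integral_mkcond.
  apply: eq_integral => x _; rewrite !patchE !mem_setE !in_itv/= andbT.
  have [x0|//] := ltP 0 x; have [//|sx] := ltP x s.
  by rewrite (max_idPr _)// subr_le0 star_noninc.
rewrite -integral_initial_split//; apply: ge0_le_integral => //.
- by move=> x _; rewrite lee_fin addr_ge0// le_max lexx orbT.
- apply/measurable_EFinP; apply: measurable_funD => //.
  by apply/measurable_EFinP; exact: mstarB.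
- exact: mstar.
move=> x /=; rewrite in_itv/= => /andP[x0 xs].
rewrite lee_fin (max_idPl _) ?subrKC// subr_ge0.
by apply: star_noninc => //; exact: ltW.
Qed.

Lemma excess_submajorized f h s : L0 f -> L0 h -> 0 < s ->
  (forall t, 0 <= t -> (excess mu t h <= excess mu t f)%E) ->
  (\int[lebesgue_measure]_(x in `]0%R, s[) (star h x)%:E <=
   \int[lebesgue_measure]_(x in `]0%R, s[) (star f x)%:E)%E.
Proof.
move=> Lf Lh s0 hf; apply: le_trans (integral_star_ge Lf s0).
have t0 := star_ge0 f s.
rewrite (le_trans (integral_star_le Lh s0 t0))// leeD2l//; exact: hf.
Qed.

End rearrangement_theory.

Lemma eq_rearrangement d1 d2 (T1 : measurableType d1) (T2 : measurableType d2)
    (R : realType) (mu1 : {measure set T1 -> \bar R})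
    (mu2 : {measure set T2 -> \bar R}) (D1 : set T1) (D2 : set T2)
    (f1 : T1 -> R) (f2 : T2 -> R) t :
  (forall a, 0 < a ->
    distribution_fun mu1 D1 f1 a = distribution_fun mu2 D2 f2 a) ->
  rearrangement mu1 D1 f1 t = rearrangement mu2 D2 f2 t.
Proof.
move=> h; rewrite /rearrangement; congr inf.
by apply/seteqP; split=> a [a0]; [rewrite h|rewrite -h].
Qed.

(** * Fully symmetric spaces on the given measure space *)

Section fully_symmetric_spaces.
Context {d : measure_display} {T : measurableType d} {R : realType}.
Variable mu : {measure set T -> \bar R}.
Implicit Types (f h : T -> R) (a s t : R).
Local Notation dist f := (distribution_fun mu setT f).
Local Notation star f := (rearrangement mu setT f).
Local Notation L0 := (L0_mu mu setT).

Lemma star_half_line f a : L0 f -> 0 <= a ->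
  half_line `&` [set t | a < `|star f t|] =
  [set t | 0 < t /\ (t%:E < dist f a)%E].
Proof.
move=> Lf a0; apply/seteqP; split=> t /=;
  rewrite ?/half_line/= ?in_itv/= ?andbT => -[t0];
  by rewrite ger0_norm ?star_ge0// lt_star.
Qed.

Lemma dist_star f a : L0 f -> 0 <= a ->
  distribution_fun (lebesgue R) half_line (star f) a = dist f a.
Proof.
move=> Lf a0; rewrite /distribution_fun star_half_line//.
exact: (@lebesgue_initial R (dist f a) (measure_ge0 _ _)).
Qed.

Lemma L0_star f : L0 f -> L0_nu (star f).
Proof.
move=> Lf; split; last first.
  have [_ [a a0 fa]] := Lf; exists a => //.
  by rewrite dist_star// ltW.
have : measurable_fun (half_line : set (lebesgueTypeR R)) (star0 mu f).
  (* [star0] is Borel, while [L0_nu] asks for measurability with respect to the completed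
     sigma-algebra. *)
  move=> mD B mB; apply: sub_caratheodory; apply: measurableI.
    exact: measurable_itv.
  by have := measurable_star0 Lf measurableT mB; rewrite setTI.
apply: eq_measurable_fun => t /set_mem/=.
by rewrite /half_line/= in_itv/= andbT /star0 => ->.
Qed.

Lemma rearrangement_star f : L0 f -> rearrangement_nu (star f) = star f.
Proof.
move=> Lf; apply/funext => t; apply: eq_rearrangement => a a0.
exact: (dist_star Lf (ltW a0)).
Qed.

Lemma starZ c f t : L0 f -> 0 < c -> 0 < t ->
  star (fun x => c * f x) t = c * star f t.
Proof.
move=> Lf c0 t0.
have distZ a : dist (fun x => c * f x) a = dist f (c^-1 * a).
  rewrite !distE; congr (mu _); apply/seteqP; split=> x /=;
    by rewrite normrM gtr0_norm// ltr_pdivrMl.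
have Lcf : L0 (fun x => c * f x).
  have [mf [a a0 fa]] := Lf; split; first exact: measurable_funM.
  by exists (c * a); rewrite ?mulr_gt0// distZ mulKf// gt_eqF.
have key a : 0 <= a -> (a < star (fun x => c * f x) t) = (a < c * star f t).
  move=> a0; rewrite lt_star// distZ -lt_star//; first by rewrite ltr_pdivrMl.
  by rewrite mulr_ge0// invr_ge0 ltW.
have c1 : 0 <= c * star f t by rewrite mulr_ge0 ?star_ge0// ltW.
apply/eqP; rewrite eq_le !leNgt key// ltxx -key ?star_ge0//.
by rewrite ltxx.
Qed.

Variables (X0 : set (R -> R)) (normX0 : (R -> R) -> R).
Hypothesis X0_fs : fully_symmetric X0 normX0.
Hypothesis mu_sigma_finite : sigma_finite setT mu.

Let X := [set f | L0 f /\ X0 (star f)].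

(** Turns majorization of rearrangements into a condition on [mu] alone; it puts the constant [1],
    the limit of averages and the oscillating function into [X]. *)
Lemma fully_symmetric_excess f h : X f -> L0 h ->
  (forall t, 0 <= t -> (excess mu t h <= excess mu t f)%E) -> X h.
Proof.
move=> [Lf Xf] Lh hf.
have sm : submajorized (star h) (star f).
  move=> s s0; rewrite (rearrangement_star Lf) (rearrangement_star Lh).
  exact: (excess_submajorized mu_sigma_finite Lf Lh s0 hf).
by split; [exact: Lh|exact: (fs_majorization X0_fs Xf (L0_star Lh) sm).1].
Qed.

(** [X] is defined through a nonlinear map, but positive factors commute with [star] on the
    half-line. *)
Lemma fully_symmetricZ c f : 0 < c -> X f -> X (fun x => c * f x).
Proof.
move=> c0 [Lf Xf]; have Lcf : L0 (fun x => c * f x).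
  have [mf [a a0 fa]] := Lf; split; first exact: measurable_funM.
  exists (c * a); rewrite ?mulr_gt0// (le_lt_trans _ fa)// !distE.
  by rewrite le_measure ?inE//; [apply: measurable_setgt; exact: measurable_funM|
    exact: measurable_setgt|move=> x /=; rewrite normrM gtr0_norm// ltr_pM2l].
have Xc : X0 (fun t => (c - 1) * star f t + star f t).
  exact: (fs_linear X0_fs).
have eq_c : eq_nu (fun t => (c - 1) * star f t + star f t)
    (star (fun x => c * f x)).
  apply: aeW => t; rewrite /half_line/= in_itv/= andbT => t0.
  by rewrite starZ//; ring.
by split; [exact: Lcf|exact: (fs_ae X0_fs Xc (L0_star Lcf).1 eq_c).1].
Qed.

Lemma excess_cst1 t : 1 <= t -> excess mu t (cst 1) = 0%E.
Proof.
move=> t1; apply: integral0_eq => x _.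
by rewrite normr1 (max_idPr _)// subr_le0.
Qed.

Lemma excess_ge_measure t f b : measurable_fun setT f -> t <= b ->
  ((b - t)%:E * mu [set x | (b < `|f x|)%R] <= excess mu t f)%E.
Proof.
move=> mf tb; have mA : measurable [set x | b < `|f x|] by exact: measurable_setgt.
rewrite -integral_cst// integral_mkcond; apply: ge0_le_integral => //.
- by move=> x _; apply: erestrict_ge0 => y _; rewrite /= lee_fin subr_ge0.
- by apply/(measurable_restrictT _ mA).1.
- by apply/measurable_EFinP; exact: measurable_excess.
move=> x _; rewrite patchE; case: ifPn => [|_]; last first.
  by rewrite lee_fin le_max lexx orbT.
by rewrite inE/= => /ltW bf; rewrite lee_fin le_max lerB.
Qed.

Lemma L0_cst1 : L0 (cst 1).
Proof.
split => //; exists 1 => //; rewrite distE (_ : [set _ | _] = set0).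
  by rewrite measure0.
by rewrite -subset0 => x /=; rewrite normr1 ltxx.
Qed.

(** After dividing by [a], [f] exceeds [1] on a set of infinite measure, so its excess is infinite
    at every [t < 1]; for [t >= 1] the excess of the constant [1] is zero. *)
Lemma fully_symmetric_cst1 f a : X f -> 0 < a -> dist f a = +oo%E -> X (cst 1).
Proof.
move=> Xf a0 fa; have ai : 0 < a^-1 by rewrite invr_gt0.
have Xaf := fully_symmetricZ ai Xf; have [[maf _] _] := Xaf.
apply: (fully_symmetric_excess Xaf L0_cst1) => t t0.
have [t1|t1] := leP 1 t; first by rewrite excess_cst1// excess_ge0.
have := excess_ge_measure maf (ltW t1).
rewrite (_ : [set x | _] = [set x | a < `|f x|]); last first.
  apply/seteqP; split=> x /=; rewrite normrM gtr0_norm//.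
    by rewrite ltr_pdivlMl// mulr1.
  by rewrite ltr_pdivlMl// mulr1.
by rewrite -distE fa gt0_muley ?lte_fin ?subr_gt0// leye_eq => /eqP ->; rewrite leey.
Qed.

End fully_symmetric_spaces.

Section R_mu_theory.
Context {d : measure_display} {T : measurableType d} {R : realType}.
Variable mu : {measure set T -> \bar R}.

(** If [f = g + h] with [g] integrable and [|h| <= M], then [(|f| - t)^+] is at most [|g|] plus [M]
    on the set where [|f| > t], which has finite measure. *)
Lemma R_mu_excess (f : T -> R) t : R_mu mu f -> 0 < t -> (excess mu t f < +oo)%E.
Proof.
move=> [Vf fR] t0.
have mf := L1Loo_measurable Vf.
have [g [h [/Lfun1P gi /LfunyP[mh [M M0 hM]] fE]]] := Vf.
have [mg g1] := gi.
pose A := [set x | t < `|f x|].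
have mA : measurable A by exact: measurable_setgt.
have Afin : (mu A < +oo)%E by rewrite -distE; exact: fR.
apply: (@le_lt_trans _ _ (norm1 mu g + M%:E * mu A)%E); last first.
  by rewrite lte_add_pinfty// lte_mul_pinfty.
have -> : (M%:E * mu A = \int[mu]_x (M * \1_A x)%:E)%E.
  under eq_integral do rewrite EFinM.
  rewrite ge0_integralZl_EFin//; first by rewrite integral_indic// setIT.
  exact/measurable_EFinP.
rewrite -ge0_integralD//; last 3 first.
- by apply/measurable_EFinP; exact: measurableT_comp.
- by move=> x _; rewrite lee_fin mulr_ge0.
- by apply/measurable_EFinP; apply: measurable_funM.
under [leRHS]eq_integral do rewrite -EFinD.
apply: ge0_le_integral_ae.
- exact: measurable_excess.
- apply: measurable_funD; first exact: measurableT_comp.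
  by apply: measurable_funM.
- by move=> x; rewrite le_max lexx orbT.
- by move=> x; rewrite addr_ge0// mulr_ge0.
apply: filterS hM => x hM; rewrite ge_max addr_ge0 ?mulr_ge0// andbT.
rewrite indicE; case: (boolP (x \in A)); rewrite ?inE /A/= => xA.
  rewrite mulr1; apply: (@le_trans _ _ `|f x|); first by rewrite gerBl ltW.
  by rewrite fE /= (le_trans (ler_normD _ _))// lerD2l.
rewrite mulr0 addr0 (le_trans _ (normr_ge0 (g x)))// subr_le0 leNgt.
by apply: contraNN xA => h0; rewrite inE.
Qed.

End R_mu_theory.

(** * A Dunford-Schwartz operator with divergent averages *)

Section dyadic_oscillation.
Context {R : realType}.

(** On the block [2^m <= k < 2^(m+1)] this is the parity of [m]. Each block is as long as everything
    before it, so the means keep oscillating. *)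
Definition dyadic (k : nat) : R := (odd (trunc_log 2 k))%:R.

Lemma dyadic_block m :
  \sum_(2 ^ m <= k < 2 ^ m.+1) dyadic k = (2 ^ m)%:R * (odd m)%:R.
Proof.
rewrite (eq_big_nat _ _ (F2 := fun=> (odd m)%:R)); last first.
  by move=> k h; rewrite /dyadic (trunc_log_eq (n := m)).
rewrite sumr_const_nat expnS mul2n -addnn addnK -[LHS]mulr_natl.
by [].
Qed.

Lemma dyadic_not_cvg (l : R) :
  ~ (n%:R^-1 * \sum_(k < n) dyadic k @[n --> \oo] --> l).
Proof.
move=> /cvgrPdist_lt/(_ 8^-1 ltac:(by rewrite invr_gt0))[N _ hN].
pose s n : R := n%:R^-1 * \sum_(k < n) dyadic k.
have hs n : (N <= n)%N -> `|l - s n| < 8^-1 by exact: hN.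
(* With both means within [1/8] of [l], this puts [l] within [3/8] of [0] and of [1]. *)
have rec m : 2 * s (2 ^ m.+1)%N - s (2 ^ m)%N = (odd m)%:R.
  have p0 : (2 ^ m)%:R != 0 :> R by rewrite pnatr_eq0 expn_eq0.
  rewrite /s -!(big_mkord xpredT dyadic).
  rewrite (big_cat_nat (n := (2 ^ m)%N))//=; last by rewrite leq_exp2l.
  rewrite dyadic_block expnS natrM; move: (_ ^ m)%:R p0 => p p0.
  by field.
have big m : (N <= m)%N -> (N <= 2 ^ m)%N.
  by move=> Nm; rewrite (leq_trans Nm)// ltnW// ltn_expl.
have key m : (N <= m)%N -> `|(odd m)%:R - l| < 3 / 8.
  move=> Nm; rewrite -rec.
  have := hs _ (big m.+1 (leqW Nm)); have := hs _ (big m Nm).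
  move: (s _) (s _) => x y; rewrite !ltr_norml => /andP[h1 h2] /andP[h3 h4].
  by apply/andP; split; lra.
have h0 := key N.*2 (leq_trans (leq_addr N N) (eq_leq (addnn N))).
have h1 := key N.*2.+1 (leqW (leq_trans (leq_addr N N) (eq_leq (addnn N)))).
move: h0 h1; rewrite /= odd_double/= !ltr_norml => /andP[a b] /andP[c e].
lra.
Qed.

End dyadic_oscillation.

(** * Shifting block means *)

Section block_shift.
Context {d : measure_display} {T : measurableType d} {R : realType}.
Variable mu : {measure set T -> \bar R}.
Local Notation V := (L1_plus_Loo mu).
Implicit Types (f g : T -> R) (c : nat -> R).

(* The pieces are differences of a subsequence of an exhaustion whose measures
   at least double at each blockwise. *)
Lemma increasing_blocks : sigma_finite setT mu -> mu setT = +oo%E ->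
  exists A : nat -> set T, [/\ forall k, measurable (A k), trivIset setT A,
    forall k, (mu (A k) < +oo)%E, forall k, (0 < mu (A k))%E &
    forall k, (mu (A k) <= mu (A k.+1))%E].
Proof.
move=> /sigma_finiteP[F [FT ndF Ffin]] muT.
have mF n : measurable (F n) by case: (Ffin n).
have cvgF : mu (F n) @[n --> \oo] --> +oo%E.
  rewrite -muT FT; apply: nondecreasing_cvg_mu => //.
  exact: bigcup_measurable.
(* Doubling makes the measures of successive differences nondecreasing; the [1] keeps them positive
   even if the first set is null. *)
have next n : exists p, (n <= p)%N /\ (mu (F n) + mu (F n) + 1 <= mu (F p))%E.
  have fin2 : (mu (F n) + mu (F n) + 1)%E \is a fin_num.
    have Fn : mu (F n) \is a fin_num by rewrite ge0_fin_numE//; case: (Ffin n).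
    by rewrite !fin_numD Fn.
  have /cvgeyPge/(_ (fine (mu (F n) + mu (F n) + 1)%E))[p _ hp] := cvgF.
  exists (maxn n p); split; first exact: leq_maxl.
  by rewrite -[leLHS]fineK// hp//= leq_maxr.
pose nx n := projT1 (cid (next n)).
have nx_ge n : (n <= nx n)%N by rewrite /nx; case: cid => /= p [].
have nx_mu n : (mu (F n) + mu (F n) + 1 <= mu (F (nx n)))%E.
  by rewrite /nx; case: cid => /= p [].
pose B k := F (iter k nx 0%N).
have mB k : measurable (B k) by exact: mF.
have Bfin k : mu (B k) \is a fin_num.
  by rewrite ge0_fin_numE//; case: (Ffin (iter k nx 0%N)).
have ndB : nondecreasing_seq B.
  by apply/nondecreasing_seqP => k; apply: ndF; exact: nx_ge.
have subB k : B k `<=` B k.+1 by apply/subsetPset; exact: ndB.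
pose b k := fine (mu (B k)).
have bE k : mu (B k) = (b k)%:E by rewrite fineK.
have b0 k : 0 <= b k by rewrite fine_ge0.
have bS k : b k + b k + 1 <= b k.+1.
  by have := nx_mu (iter k nx 0%N); rewrite -/(B k) -[F _]/(B k.+1) !bE.
have AE k : mu (B k.+1 `\` B k) = (b k.+1 - b k)%:E.
  rewrite measureD//=; last by rewrite bE ltry.
  by rewrite setIidr// !bE.
exists (fun k => B k.+1 `\` B k); split.
- by move=> k; exact: measurableD.
- apply/trivIsetP => i j _ _; wlog ij : i j / (i < j)%N.
    move=> H; rewrite neq_ltn => /orP[ij|ij].
      by apply: (H i j ij); rewrite ltn_eqF.
    by rewrite setIC; apply: (H j i ij); rewrite ltn_eqF.
  move=> _; rewrite -subset0 => x [[Bi _] [_ nBj]]; apply: nBj.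
  by move: Bi; apply/subsetPset; exact: ndB.
- by move=> k; rewrite AE ltry.
- by move=> k; rewrite AE lte_fin; have := bS k; have := b0 k; lra.
- by move=> k; rewrite !AE lee_fin; have := bS k.+1; have := b0 k; have := bS k; lra.
Qed.

Variable A : nat -> set T.
Hypotheses (mA : forall k, measurable (A k)) (tA : trivIset setT A)
  (Afin : forall k, (mu (A k) < +oo)%E) (A0 : forall k, (0 < mu (A k))%E)
  (Amono : forall k, (mu (A k) <= mu (A k.+1))%E).

Definition blockwise c (x : T) : R :=
  if pselect (exists k, A k x) is left h then c (projT1 (cid h)) else 0.

Lemma blockwise_on c k x : A k x -> blockwise c x = c k.
Proof.
move=> Ax; rewrite /blockwise; case: pselect => [h|]; last by case; exists k.
case: cid => j /= Aj; congr c; apply: contrapT => /eqP jk.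
have /trivIsetP/(_ j k I I jk) := tA.
by rewrite -subset0 => /(_ x); apply.
Qed.

Lemma blockwise_off c x : ~ (\bigcup_k A k) x -> blockwise c x = 0.
Proof.
move=> nA; rewrite /blockwise; case: pselect => // -[k Ak].
by exfalso; apply: nA; exists k.
Qed.

Lemma blockwiseP c (P : T -> R -> Prop) : (forall k x, A k x -> P x (c k)) ->
  (forall x, P x 0) -> forall x, P x (blockwise c x).
Proof.
move=> h1 h0 x; have [[k _ Ax]|nA] := pselect ((\bigcup_k A k) x).
  by rewrite (blockwise_on c Ax); exact: h1.
by rewrite blockwise_off.
Qed.

Lemma measurable_blockwise c : measurable_fun setT (blockwise c).
Proof.
apply: (measurability _ (RGenOInfty.measurableE R)) => //.
move=> _ [_ [a ->] <-]; rewrite setTI preimage_itvoy.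
rewrite (_ : [set x | _] = \bigcup_(k in [set k | a < c k]) A k `|`
    (if a < 0 then ~` \bigcup_k A k else set0)).
  apply: measurableU; first by apply: bigcup_measurable.
  by case: ifP => // _; apply: measurableC; exact: bigcup_measurable.
apply/seteqP; split=> x /=.
  have [[k _ Ax]|nA] := pselect ((\bigcup_k A k) x).
    by rewrite (blockwise_on c Ax) => ac; left; exists k.
  by rewrite blockwise_off// => ->; right.
move=> [[k /= ac Ax]|]; first by rewrite (blockwise_on c Ax).
by case: ifP => // a0 nA; rewrite blockwise_off.
Qed.

Lemma blockwise_lin (a : R) c1 c2 x :
  blockwise (fun k => a * c1 k + c2 k) x = a * blockwise c1 x + blockwise c2 x.
Proof.
have [[k _ Ax]|nA] := pselect ((\bigcup_k A k) x).
  by rewrite !(blockwise_on _ Ax).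
by rewrite !blockwise_off// mulr0 addr0.
Qed.

Definition mean f k : R := fine (\int[mu]_(x in A k) (f x)%:E) / fine (mu (A k)).

Definition block_shift f : T -> R := blockwise (fun k => mean f k.+1).

Let muAE k : mu (A k) = (fine (mu (A k)))%:E.
Proof. by rewrite fineK// ge0_fin_numE. Qed.

Let muA_gt0 k : 0 < fine (mu (A k)).
Proof. by rewrite fine_gt0// A0 Afin. Qed.

Lemma L1Loo_integrable_on f k : V f -> mu.-integrable (A k) (EFin \o f).
Proof.
move=> [g [h [/Lfun1P/integrable1P gi /LfunyP[mh [M M0 hM]] ->]]].
apply: (@eq_integrable _ _ _ _ _ (mA k) ((EFin \o g) \+ (EFin \o h)))%E.
  by [].
apply: integrableD => //; first exact: integrableS gi.
apply/integrableP; split; first exact/measurable_EFinP/measurable_funTS.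
rewrite (@le_lt_trans _ _ (M%:E * mu (A k))%E)// ?lte_mul_pinfty//.
apply: integral_le_bound => //.
  exact/measurable_EFinP/measurable_funTS.
by apply: filterS hM => x hM _; rewrite lee_fin.
Qed.

Lemma mean_lin a f g k : V f -> V g ->
  mean (fun x => a * f x + g x) k = a * mean f k + mean g k.
Proof.
move=> Vf Vg; have fi := L1Loo_integrable_on k Vf; have gi := L1Loo_integrable_on k Vg.
rewrite /mean mulrA -mulrDl; congr (_ / _).
have -> : (\int[mu]_(x in A k) (a * f x + g x)%:E =
    a%:E * \int[mu]_(x in A k) (f x)%:E + \int[mu]_(x in A k) (g x)%:E)%E.
  rewrite -integralZl// -integralD//.
  exact: integrableZl.
rewrite fineD ?fineM//; try exact: integrable_fin_num.
by rewrite fin_numM// integrable_fin_num.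
Qed.

Lemma mean_eq f g k : V f -> V g -> (\forall x \ae mu, f x = g x) ->
  mean f k = mean g k.
Proof.
move=> Vf Vg fg; rewrite /mean; congr (fine _ / _); apply: ae_eq_integral => //.
- exact/measurable_EFinP/measurable_funTS/(L1Loo_measurable Vf).
- exact/measurable_EFinP/measurable_funTS/(L1Loo_measurable Vg).
- by apply: filterS fg => x -> _.
Qed.

Lemma norm_mean f k : V f ->
  ((`|mean f k| * fine (mu (A k)))%:E <= \int[mu]_(x in A k) (`|f x|)%:E)%E.
Proof.
move=> Vf; have fi := L1Loo_integrable_on k Vf.
have mf : measurable_fun (A k) (EFin \o f) by exact: (measurable_int _ fi).
rewrite /mean normrM normfV (gtr0_norm (muA_gt0 k)) divfK ?gt_eqF//.
have := le_abse_integral mu (mA k) mf; rewrite -[X in (`|X| <= _)%E]fineK//.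
exact: integrable_fin_num.
Qed.

Lemma mean_bounded M f k : V f -> 0 <= M -> ae_bounded mu M f ->
  `|mean f k| <= M.
Proof.
move=> Vf M0 fM; rewrite -(ler_pM2r (muA_gt0 k)) -lee_fin.
rewrite (le_trans (norm_mean k Vf))// EFinM -muAE.
apply: (integral_le_bound (f := EFin \o f)) => //.
  exact/measurable_EFinP/measurable_funTS/(L1Loo_measurable Vf).
by apply: filterS fM => x fM _; rewrite lee_fin.
Qed.

Lemma block_shift_bounded M f : V f -> 0 <= M -> ae_bounded mu M f ->
  forall x, `|block_shift f x| <= M.
Proof.
move=> Vf M0 fM; apply: (@blockwiseP _ (fun x r => `|r| <= M)).
  by move=> k x _; exact: mean_bounded.
by move=> x; rewrite normr0.
Qed.

(** On [A k] the image has mass [|mean f k.+1| * mu (A k)]. By [Amono] this is at most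
    [|mean f k.+1| * mu (A k.+1)], hence at most the mass of [f] on [A k.+1]. *)
Lemma block_shift_norm1 f : integrable1 mu f ->
  (norm1 mu (block_shift f) <= norm1 mu f)%E.
Proof.
move=> fi; have Vf := integrable1_L1Loo fi; have [mf _] := fi.
have mU : measurable (\bigcup_k A k) by exact: bigcup_measurable.
have mU1 : measurable (\bigcup_k A k.+1) by exact: bigcup_measurable.
have mS : measurable_fun setT (fun x => (`|block_shift f x|)%:E).
  by apply/measurable_EFinP; apply: measurableT_comp => //; exact: measurable_blockwise.
have mf' : measurable_fun setT (fun x => (`|f x|)%:E).
  by apply/measurable_EFinP; exact: measurableT_comp.
have -> : norm1 mu (block_shift f) =
    (\int[mu]_(x in \bigcup_k A k) (`|block_shift f x|)%:E)%E.
  rewrite [RHS]integral_mkcond; apply: eq_integral => x _; rewrite patchE.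
  case: (boolP (x \in _)) => // nA; rewrite /block_shift blockwise_off ?normr0//.
  by move=> h; move: nA; rewrite mem_set.
apply: (@le_trans _ _ (\int[mu]_(x in \bigcup_k A k.+1) (`|f x|)%:E)%E); last first.
  exact: ge0_subset_integral.
have tA1 : trivIset setT (fun k => A k.+1).
  apply/trivIsetP => i j _ _ ij.
  by have /trivIsetP/(_ i.+1 j.+1 I I) := tA; rewrite eqSS; apply.
rewrite ge0_integral_bigcup//; last exact: measurable_funTS.
rewrite ge0_integral_bigcup//; last exact: measurable_funTS.
apply: lee_nneseries => [k _ _|k _]; first exact: integral_ge0.
rewrite (eq_integral (cst (`|mean f k.+1|)%:E)); last first.
  by move=> x /set_mem Ax; rewrite /block_shift (blockwise_on _ Ax).
rewrite integral_cst// (le_trans _ (norm_mean k.+1 Vf))// EFinM -muAE.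
by rewrite lee_wpmul2l.
Qed.

Lemma DS_block_shift : DS mu block_shift.
Proof.
apply: DSI.
- move=> f Vf; have [g [h [/Lfun1P gi /LfunyP[mh [M M0 hM]] fE]]] := Vf.
  have Vg := integrable1_L1Loo gi; have Vh := ae_bounded_L1Loo mh hM.
  (* Membership in [L1_plus_Loo] asks for a decomposition, and linearity transports the one of
     [f]. *)
  have -> : block_shift f = (fun x => block_shift g x + block_shift h x).
    apply/funext => x; rewrite -[block_shift g x]mul1r /block_shift -blockwise_lin.
    congr (blockwise _ x); apply/funext => k; rewrite -mean_lin//; congr (mean _ _).
    by rewrite fE; apply/funext => y /=; rewrite mul1r.
  apply: L1LooD.
    apply: integrable1_L1Loo; split; first exact: measurable_blockwise.
    by rewrite (le_lt_trans (block_shift_norm1 gi))//; case: gi.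
  apply: (@ae_bounded_L1Loo _ _ _ _ M); first exact: measurable_blockwise.
  by apply: aeW; exact: block_shift_bounded.
- move=> f g Vf Vg fg; apply: aeW => x; rewrite /block_shift; congr (blockwise _ x).
  by apply/funext => k; exact: mean_eq.
- move=> c f g Vf Vg; apply: aeW => x; rewrite /block_shift -blockwise_lin.
  by congr (blockwise _ x); apply/funext => k; exact: mean_lin.
- exact: block_shift_norm1.
- by move=> c f mf c0 fc; apply: aeW; apply: block_shift_bounded => //;
    exact: ae_bounded_L1Loo fc.
Qed.

Lemma block_shift_blockwise c : block_shift (blockwise c) = blockwise (fun k => c k.+1).
Proof.
rewrite /block_shift; congr blockwise; apply/funext => k; rewrite /mean.
rewrite (eq_integral (cst (c k.+1)%:E)); last first.
  by move=> x /set_mem Ax; rewrite (blockwise_on _ Ax).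
by rewrite integral_cst// muAE -EFinM/= mulfK// gt_eqF.
Qed.

Lemma average_block_shift c n x : A 0%N x ->
  average block_shift n (blockwise c) x = n%:R^-1 * \sum_(k < n) c k.
Proof.
move=> Ax; rewrite /average; congr (_ * _); apply: eq_bigr => k _.
have -> : iter k block_shift (blockwise c) = blockwise (fun j => c (j + k)%N).
  elim: (k : nat) => [|m ih] /=; first by under [in RHS]eq_fun do rewrite addn0.
  rewrite ih block_shift_blockwise; congr blockwise.
  by apply/funext => j; rewrite addSnnS.
by rewrite (blockwise_on _ Ax) add0n.
Qed.

Lemma block_shift_not_au_cvg v :
  ~ au_cvg mu (fun n => average block_shift n (blockwise dyadic)) v.
Proof.
(* Half the measure of [A 0]: the discarded set cannot cover [A 0], even up to a null set. *)
move=> au; pose e := fine (mu (A 0%N)) / 2.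
have e0 : 0 < e by rewrite divr_gt0.
have [E [mE nE cE]] := au e e0.
pose u n x := (v x - average block_shift n (blockwise dyadic) x) * \1_E x.
have H j : exists n, forall k, (n <= k)%N -> ae_bounded mu j.+1%:R^-1 (u k).
  have j0 : 0 < j.+1%:R^-1 :> R by rewrite invr_gt0.
  have /fine_cvgP[[n1 _ fin] /cvgrPdist_le/(_ _ j0)[n2 _ hn2]] := cE.
  exists (maxn n1 n2) => k; rewrite geq_max => /andP[nk1 nk2].
  apply/Lnormy_le; first exact: ltW.
  rewrite -[leLHS]fineK; last exact: fin.
  rewrite lee_fin; have := hn2 k nk2; rewrite /= sub0r normrN.
  exact/le_trans/ler_norm.
pose n j := projT1 (cid (H j)).
have hn j k : \forall x \ae mu, (n j <= k)%N -> `|u k x| <= j.+1%:R^-1.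
  have [nk|nk] := leqP (n j) k; last by exact: aeW.
  rewrite /n in nk; case: cid nk => /= m hm /hm.
  by apply: filterS => x.
have /ae_foralln hae : forall j, \forall x \ae mu, forall k, (n j <= k)%N ->
    `|u k x| <= j.+1%:R^-1.
  by move=> j; apply/ae_foralln => k; exact: hn.
(* A single point of convergence in [A 0] suffices, since the averages there are exactly the Cesaro
   means of [dyadic]. *)
have [x [Ax Ex hx]] : exists x, [/\ A 0%N x, E x & forall j k, (n j <= k)%N ->
    `|u k x| <= j.+1%:R^-1].
  apply: contrapT => no.
  have : (mu (A 0%N) <= mu (~` E))%E.
    apply: le_measure_ae => //; first exact: measurableC.
    by apply: filterS hae => x hx Ax Ex; apply: no; exists x.
  move=> /le_trans/(_ nE); rewrite muAE lee_fin /e.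
  by have := muA_gt0 0; lra.
apply: (@dyadic_not_cvg R (v x)); apply/cvgrPdist_le => eps eps0.
pose j := Num.bound eps^-1.
exists (n j) => // k /= nk; have := hx j k nk.
rewrite /u indicE mem_set// mulr1 average_block_shift// => /le_trans; apply.
rewrite invf_ple ?posrE// (@le_trans _ _ j%:R)//.
  by rewrite ltW// archi_boundP// invr_ge0 ltW.
by rewrite ler_nat.
Qed.

Lemma blockwise_dyadic_bounded x : `|blockwise dyadic x| <= 1.
Proof.
apply: (@blockwiseP _ (fun x r => `|r| <= 1)) => [k y _|y]; last by rewrite normr0.
by rewrite /dyadic; case: odd; rewrite ?normr1 ?normr0.
Qed.

End block_shift.

(** * The equivalence *)

Section ergodic_theorem.
Context {d : measure_display} {T : measurableType d} {R : realType}.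
Variable mu : {measure set T -> \bar R}.

Lemma excess_limit (u : nat -> T -> R) (v f : T -> R) t :
  (forall n, measurable_fun setT (u n)) -> measurable_fun setT v ->
  (\forall x \ae mu, u n x @[n --> \oo] --> v x) ->
  (forall n, (excess mu t (u n) <= excess mu t f)%E) ->
  (excess mu t v <= excess mu t f)%E.
Proof.
move=> mu_ mv uv uf.
pose g n x : \bar R := (Num.max (`|u n x| - t) 0)%:E.
have mg n : measurable_fun setT (g n).
  by apply/measurable_EFinP; exact: measurable_excess.
have g0 n x : (0 <= g n x)%E by rewrite lee_fin le_max lexx orbT.
apply: (@le_trans _ _ (\int[mu]_x limn_einf (g ^~ x))%E).
  apply: ae_ge0_le_integral => //.
  - by move=> x _; rewrite lee_fin le_max lexx orbT.
  - by apply/measurable_EFinP; exact: measurable_excess.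
  - move=> x _; rewrite limn_einf_lim; apply: lime_ge; first exact: is_cvg_einfs.
    by apply: nearW => n; apply/ereal_infP => _ [k _ <-].
  - rewrite /limn_einf; apply: measurableT_comp => //.
    apply: measurable_fun_limn_esup => n; exact: measurableT_comp.
  apply: filterS uv => x uv _.
  have gv : g n x @[n --> \oo] --> (Num.max (`|v x| - t) 0)%:E.
    (* Reduces the limit of the positive part to limits of sums, products and absolute values. *)
    have maxE (y : R) : Num.max y 0 = 2^-1 * (y + `|y|).
      rewrite /Num.max; case: ltP => y0.
        by rewrite ltr0_norm// subrr mulr0.
      by rewrite ger0_norm//; field.
    have cu : `|u n x| - t @[n --> \oo] --> `|v x| - t.
      by apply: cvgB; [exact: cvg_norm|exact: cvg_cst].
    apply: cvg_EFin; first exact: nearW.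
    rewrite maxE (_ : fine \o _ =
      (fun n => 2^-1 * (`|u n x| - t + `|(`|u n x| - t)|))); last first.
      by apply/funext => n /=; rewrite maxE.
    apply: cvgM; first exact: cvg_cst.
    by apply: cvgD => //; exact: cvg_norm.
  by rewrite (cvg_limn_einf_sup gv).1.
apply: (le_trans (fatou _ measurableT mg (fun n x _ => g0 n x))).
rewrite limn_einf_lim; apply: lime_le; first exact: is_cvg_einfs.
by apply: nearW => n; apply: le_trans (uf n); apply: ereal_inf_lbound; exists n => /=.
Qed.

Lemma average_au_cvg S f : DS mu S -> R_mu mu f ->
  exists v, [/\ measurable_fun setT v, au_cvg mu (fun n => average S n f) v &
    forall t, 0 <= t -> (excess mu t v <= excess mu t f)%E].
Proof.
move=> DSS Rf; have [Vf _] := Rf.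
have mav n : measurable_fun setT (average S n f).
  exact: (DS_measurable (DS_average n DSS)).
have [v [mv auv cv]] := au_cvg_of_nearly_constant mav
  (fun a e => averages_nearly_constant (a := a) (e := e) DSS Vf
    (fun t => R_mu_excess (t := t) Rf)).
exists v; split => // t t0; apply: (excess_limit mav mv cv) => n.
exact: (DS_excess (DS_average n DSS)).
Qed.

(** Where [|f| > t + 1], the integrand of [excess mu t f] exceeds [1]. *)
Lemma L0_of_excess (f : T -> R) t : measurable_fun setT f -> 0 < t ->
  (excess mu t f < +oo)%E -> L0_mu mu setT f.
Proof.
move=> mf t0 ft; split => //; exists (t + 1); first by rewrite addr_gt0.
have := excess_ge_measure mu mf (_ : t <= t + 1).
rewrite lerDl ler01 => /(_ isT); rewrite [X in X%:E]addrAC subrr add0r mul1e.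
by rewrite distE => /le_lt_trans; apply.
Qed.

End ergodic_theorem.

Theorem theorem3p4 (R : realType) (d : measure_display) (T : measurableType d)
  (mu : {measure set T -> \bar R})
  (mu_complete : measure_is_complete mu)
  (mu_sigma_finite : sigma_finite [set: T] mu)
  (mu_qna : quasi_non_atomic mu)
  (mu_infinite : mu [set: T] = +oo%E)
  (X : set (T -> R)) (normX : (T -> R) -> R)
  (X_fs : fully_symmetric_on mu X normX)
  (X_sub : X `<=` L1_plus_Loo mu) :
  let i := X `<=` R_mu mu in
  let ii := ~ X (cst 1) in
  let iii := forall (f : T -> R) (S : (T -> R) -> (T -> R)), X f -> DS mu S ->
    exists2 fhat : T -> R, X fhat &
      au_cvg mu (fun n : nat => average S n f) fhat in
  (i <-> ii) /\ (ii <-> iii).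
Proof.
move=> i ii iii; have [X0 [normX0 [X0_fs XE _]]] := X_fs.
have i_ii : i -> ii.
  move=> Xi X1; have [_ /(_ 2^-1)] := Xi _ X1.
  rewrite invr_gt0 ltr0n => /(_ isT).
  rewrite distE (_ : [set _ | _] = setT) ?mu_infinite//.
  by apply/seteqP; split=> // x _ /=; rewrite normr1 invf_lt1// ltr1n.
have ii_i : ii -> i.
  move=> X1 f Xf; split; first exact: X_sub.
  move=> a a0; rewrite ltey; apply/eqP => fa; apply: X1.
  move: Xf; rewrite XE => Xf.
  exact: (fully_symmetric_cst1 X0_fs mu_sigma_finite Xf a0 fa).
have i_iii : i -> iii.
  move=> Xi f S Xf DSS; have Rf := Xi _ Xf.
  have [v [mv auv vf]] := average_au_cvg DSS Rf.
  have Lv : L0_mu mu setT v.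
    apply: (L0_of_excess mv ltr01).
    by rewrite (le_lt_trans (vf 1 ler01))// R_mu_excess.
  exists v => //; move: Xf; rewrite XE => Xf.
  exact: (fully_symmetric_excess X0_fs mu_sigma_finite Xf Lv vf).
have iii_ii : iii -> ii.
  move=> Xiii X1.
  have [A [mA tA Afin A0 Amono]] := increasing_blocks mu_sigma_finite mu_infinite.
  have m_osc := measurable_blockwise mA tA (@dyadic R).
  have X_osc : X (blockwise A dyadic).
    move: X1; rewrite XE => X1.
    (* The oscillating function is at most [1] in modulus, so its excess is below that of the
       constant at every height. *)
    apply: (fully_symmetric_excess X0_fs mu_sigma_finite X1).
      split => //; exists 1 => //; rewrite distE (_ : [set _ | _] = set0).
        by rewrite measure0.
      rewrite -subset0 => x /=; rewrite ltNge => /negP; apply.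
      exact: blockwise_dyadic_bounded.
    move=> t t0; apply: ge0_le_integral_ae.
    - exact: measurable_excess.
    - exact: measurable_excess.
    - by move=> x; rewrite le_max lexx orbT.
    - by move=> x; rewrite le_max lexx orbT.
    apply: aeW => x; rewrite normr1 ge_max le_max lerD2r blockwise_dyadic_bounded//=.
    by rewrite le_max lexx orbT.
  have [v _] := Xiii _ _ X_osc (DS_block_shift mA tA Afin A0 Amono).
  exact: block_shift_not_au_cvg.
by split; split => //; tauto.
Qed.
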